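(* Let $J:=\operatorname{conv}\{\mathbf{v}_0,\mathbf{v}_1,\dots,\mathbf{v}_d\}\subset\mathbb{R}^d_{\ge0}\setminus\{\mathbf{0}\}$ be a $d$-simplex and let $f(\mathbf{x})=(\mathbf{c}^\top\mathbf{x})^q$ with $\mathbf{c}\neq\mathbf{0}$ and $q$ an even positive integer. Then $$\frac{\operatorname{vol}(P^0(f,J))-\operatorname{vol}(P(f,J))}{\operatorname{vol}(P^0(f,J))}\ge\frac{q-1}{\frac{(q+d+1)!}{q!\,(d+1)!}2^{q/2}(q/2)!-(d+2)}.$$
   Context: Let $\mu$ be the unique affine function agreeing with $f$ at the vertices of $J$ and $\mu(\mathbf{x},z):=z\mu(\mathbf{x}/z)$ (extended linearly in $(\mathbf{x},z)$). For $z\ge0$, $z\cdot J:=\{z\mathbf{x}:\mathbf{x}\in J\}$. Perspective relaxation: $P(f,J):=\operatorname{cl}\{(\mathbf{x},y,z)\in\mathbb{R}^d\times\mathbb{R}\times\mathbb{R}:\mu(\mathbf{x},z)\ge y\ge zf(\mathbf{x}/z),\ \mathbf{x}\in z\cdot J,\ 1\ge z>0\}$. Naive relaxation: $P^0(f,J):=\{(\mathbf{x},y,z)\in\mathbb{R}^d\times\mathbb{R}\times\mathbb{R}:\mu(\mathbf{x},z)\ge y\ge f(\mathbf{x}),\ \mathbf{x}\in z\cdot J,\ 1\ge z\ge0\}$. $\operatorname{vol}$ is $(d+2)$-dimensional Lebesgue measure. *)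

(* Defs.v *)
From HB Require Import structures.
From mathcomp Require Import all_boot all_order all_algebra.
From mathcomp Require Import all_classical all_reals all_analysis.
Set Implicit Arguments. Unset Strict Implicit. Unset Printing Implicit Defensive.
Import Order.TTheory GRing.Theory Num.Theory.
Import numFieldNormedType.Exports numFieldTopology.Exports.
Local Open Scope classical_set_scope.
Local Open Scope ring_scope.

Section Defs.
Variable R : realType.

Definition dotp (d : nat) (u w : 'rV[R]_d) : R := \sum_(j < d) u 0 j * w 0 j.

Definition conv_hull (d n : nat) (v : 'I_n -> 'rV[R]_d) : set 'rV[R]_d :=
  [set x | exists lam : 'I_n -> R,
     (forall i, 0 <= lam i) /\ \sum_(i < n) lam i = 1 /\
     x = \sum_(i < n) lam i *: v i].

Definition affinely_independent (d : nat) (v : 'I_d.+1 -> 'rV[R]_d) : Prop :=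
  row_free (\matrix_(i < d) (v (lift ord0 i) - v ord0)).

Definition scale_set (d : nat) (z : R) (J : set 'rV[R]_d) : set 'rV[R]_d :=
  [set z *: x | x in J].

(* homogenization of the affine function mu(x) = a.x + b :
   mu(x,z) = z mu(x/z) extended linearly, i.e. a.x + b z *)
Definition mu_hom (d : nat) (a : 'rV[R]_d) (b : R) (x : 'rV[R]_d) (z : R) : R :=
  dotp a x + b * z.

Definition persp_relax (d : nat) (f : 'rV[R]_d -> R) (a : 'rV[R]_d) (b : R)
    (J : set 'rV[R]_d) : set ('rV[R]_d * R * R) :=
  @closure ('rV[R]_d * R * R)%type [set p : 'rV[R]_d * R * R | let: (x, y, z) := p in
     mu_hom a b x z >= y /\ y >= z * f (z^-1 *: x) /\
     scale_set z J x /\ 0 < z <= 1].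

Definition naive_relax (d : nat) (f : 'rV[R]_d -> R) (a : 'rV[R]_d) (b : R)
    (J : set 'rV[R]_d) : set ('rV[R]_d * R * R) :=
  [set p | let: (x, y, z) := p in
     mu_hom a b x z >= y /\ y >= f x /\
     scale_set z J x /\ 0 <= z <= 1].

Fixpoint iter_integral (n : nat) (g : seq R -> \bar R) : \bar R :=
  match n with
  | 0 => g [::]
  | n'.+1 => (\int[@lebesgue_measure R]_t iter_integral n' (fun s => g (t :: s)))%E
  end.

Definition point_of (d : nat) (s : seq R) : 'rV[R]_d * R * R :=
  (\row_(j < d) nth 0 s j, nth 0 s d, nth 0 s d.+1).

(* (d+2)-dimensional Lebesgue measure of A (a subset of R^d x R x R),
   computed as the iterated integral of its indicator (Tonelli) *)
Definition vol (d : nat) (A : set ('rV[R]_d * R * R)) : \bar R :=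
  iter_integral d.+2 (fun s => (\1_A (point_of d s))%:E).

End Defs.

(* Main.v *)
Require Import Defs.
From HB Require Import structures.
From mathcomp Require Import all_boot all_order all_algebra.
From mathcomp Require Import all_classical all_reals all_analysis.
From mathcomp Require Import measurable_realfun ring lra.
Set Implicit Arguments. Unset Strict Implicit. Unset Printing Implicit Defensive.
Import Order.TTheory GRing.Theory Num.Theory.
Import numFieldNormedType.Exports numFieldTopology.Exports.
Local Open Scope classical_set_scope.
Local Open Scope ring_scope.

(* Put w_i := c.v_i and let h_q be the complete homogeneous symmetric polynomial.
   For z > 0 both relaxations are {(x, y, z) | z^e f(x/z) <= y <= mu(x, z),
   x in z.J, z <= 1}, with e = q for the naive one and e = 1 for the perspective
   one, and the slice z = 0 is negligible.  Substituting x = z(v_0 + sum_i u_i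
   (v_i - v_0)) gives both volumes as K (M/(d+2) - F/(e+d+1)), where M and F are
   the integrals over the standard simplex of the pullbacks of mu and f:
     M = (sum_i w_i^q) / (d+1)!,   F = q!/(q+d)! h_q(w).
   The inequality thus reduces to h_q(w) >= (sum_i w_i^q) / (2^(q/2) (q/2)!), which
   follows from Hunter's bound h_{2p}(w) >= (sum_i w_i^2)^p / (2^p p!). *)

(** * Complete homogeneous symmetric polynomials *)

(** With [x = d + 2] and [y = q + d + 1] the ratio equals [(y - x) F / (y M - x F)]: the Jacobian
    factor [K] cancels and the ratio grows with [F / M], so only a lower bound on
    [h_q(w) / \sum_i w_i ^ q] is at stake. The [w_i] may have either sign, so even [h_q(w) >= 0]
    cannot be read off the monomials; Hunter's bound is proved by following [h] while one constant
    is added to all variables. On the analytic side, [vol] is an iterated one-dimensional integral,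
    so the linear change of variables is carried out by Gaussian elimination on the integration
    variables, each exchange being an instance of Tonelli. Since [K] cancels, it only has to be
    positive and common to both regions. Convexity enters through [f <= mu] on [J]: it makes the
    length of each [y]-slice the plain difference of its endpoints, so that its integral splits into
    an [M] part and an [F] part. *)

Section hsym.
Variable R : comNzRingType.
Implicit Types (l : seq R) (k : nat).

(** Coefficient of [t ^ k] in the product of the series [1 / (1 - x t)] over [l]. Multiplying by one
    factor [1 - x t] gives the recurrence, which decreases either the list or the degree; hence the
    nested fixpoints. *)
Fixpoint hsym l : nat -> R :=
  match l with
  | [::] => fun k => (k == 0%N)%:R
  | x :: l' => fix hsymx k :=
      match k with
      | 0 => 1
      | k'.+1 => hsym l' k'.+1 + x * hsymx k'
      end
  end.
Arguments hsym : simpl never.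

Lemma hsym0 l : hsym l 0 = 1.
Proof. by case: l. Qed.

Lemma hsymS x l k : hsym (x :: l) k.+1 = hsym l k.+1 + x * hsym (x :: l) k.
Proof. by []. Qed.

Lemma hsym1 l : hsym l 1 = \sum_(x <- l) x.
Proof.
elim: l => [|x l IH]; first by rewrite big_nil.
by rewrite hsymS hsym0 mulr1 IH big_cons addrC.
Qed.

Lemma hsym_swap x y l k : hsym (x :: y :: l) k = hsym (y :: x :: l) k.
Proof.
elim/ltn_ind: k => -[//|[|k]] IH.
  by rewrite !hsymS !hsym0 !mulr1 addrAC.
have H := IH k.+1 (ltnSn _); have H2 := IH k (ltnW (ltnSn _)).
have Hx : hsym (x :: y :: l) k.+1 = hsym (x :: l) k.+1 + y * hsym (y :: x :: l) k.
  by rewrite H.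
have Hy : hsym (y :: x :: l) k.+1 = hsym (y :: l) k.+1 + x * hsym (x :: y :: l) k.
  by rewrite -H.
rewrite hsymS [RHS]hsymS Hx Hy [hsym (y :: l) k.+2]hsymS [hsym (x :: l) k.+2]hsymS H2.
by ring.
Qed.

(** Euler's identity for a homogeneous polynomial of degree [k.+1]: the partial derivative of
    [h_{k+1}] in the variable [x] is [h_k] with [x] repeated once more. *)
Lemma hsym_euler l k :
  k.+1%:R * hsym l k.+1 = \sum_(x <- l) x * hsym (x :: l) k.
Proof.
elim: l k => [|y l IHl]; first by move=> k; rewrite big_nil mulr0.
elim=> [|k IHk].
  rewrite hsym1 mul1r; apply: eq_bigr => x _; by rewrite hsym0 mulr1.
rewrite big_cons.
under eq_bigr do rewrite hsym_swap hsymS mulrDr.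
rewrite big_split /= -IHl.
have -> : \sum_(x <- l) x * (y * hsym (y :: x :: l) k) =
   y * (k.+1%:R * hsym (y :: l) k.+1 - y * hsym (y :: y :: l) k).
  rewrite IHk big_cons [X in X - _]addrC addrK mulr_sumr; apply: eq_bigr => x _.
  by rewrite hsym_swap mulrCA.
rewrite [hsym (y :: y :: l) _]hsymS hsymS.
move: (hsym (y :: y :: l) k) (hsym (y :: l) k.+1) (hsym l k.+2) => A B C.
rewrite -[k.+2%:R]natr1; ring.
Qed.

Lemma hsymN l k : hsym [seq - x | x <- l] k = (-1) ^+ k * hsym l k.
Proof.
elim: l k => [|x l IHl] k; first by case: k => [|k]; rewrite /= ?mulr0// mulr1.
elim: k => [|k IHk]; first by rewrite !hsym0 mulr1.
rewrite map_cons !hsymS -map_cons IHl IHk exprS; ring.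
Qed.

End hsym.
Arguments hsym : simpl never.

(** * Hunter's lower bound in even degree *)

Section hsym_real.
Variable R : realType.
Implicit Types (l : seq R) (k : nat).

(** The derivative is the sum of the partial derivatives [h_k (x :: l)]. A monomial of degree [k]
    with exponents [e_i] occurs in it [\sum_i (e_i + 1) = size l + k] times. *)
Lemma is_derive_hsym_shift l k (s : R) :
  is_derive s 1 (fun s => hsym [seq x + s | x <- l] k.+1)
    ((size l + k)%:R * hsym [seq x + s | x <- l] k).
Proof.
elim: l k => [|x l IHl] k.
  case: k => [|k]; rewrite /= ?add0n ?mulr0 ?mul0r; exact: is_derive_cst.
have D2 : is_derive s 1 (fun s0 => x + s0) (0 + 1).
  exact: (is_deriveD (is_derive_cst _ _ _) (is_derive_id _ _)).
elim: k => [|k IHk].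
  rewrite (_ : (fun s0 => hsym _ 1) =
    (fun s0 => hsym [seq x + s0 | x <- l] 1) + (fun s0 => x + s0)); last first.
    by apply/funext => t; rewrite /= hsymS hsym0 mulr1.
  have := IHl 0%N; rewrite hsym0 mulr1 addn0 => D1.
  apply: (is_derive_eq (is_deriveD D1 D2)).
  by rewrite hsym0 /= add0r addn0 mulr1 -natr1.
rewrite (_ : (fun s0 => hsym _ k.+2) =
  (fun s0 => hsym [seq x + s0 | x <- l] k.+2) +
  (fun s0 => x + s0) * (fun s0 => hsym [seq y + s0 | y <- x :: l] k.+1)); last first.
  by apply/funext => t; rewrite /= hsymS.
apply: (is_derive_eq (is_deriveD (IHl k.+1) (is_deriveM D2 IHk))).
rewrite /= hsymS /GRing.scale /=.
move: (hsym _ k.+1) (hsym _ k) => A B.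
rewrite !addSn !addnS -!natr1 !natrD; ring.
Qed.


Lemma hsym_ge0 l k : all (>= 0) l -> 0 <= hsym l k.
Proof.
elim: l k => [|x l IHl] k; first by rewrite ler0n.
move=> /= /andP[x0 l0]; elim: k => [|k IHk]; first by rewrite hsym0.
by rewrite hsymS addr_ge0 ?IHl// mulr_ge0.
Qed.

Lemma hsym_shift_continuous l k : continuous (fun s : R => hsym [seq x + s | x <- l] k).
Proof.
move=> s; case: k => [|k].
  rewrite (_ : (fun _ => _) = cst 1); first exact: cvg_cst.
  by apply/funext => t; rewrite hsym0.
have [D _] := is_derive_hsym_shift l k s.
by apply: differentiable_continuous; exact/derivable1_diffP.
Qed.

Lemma hsym_shift_derive1 l k (s : R) :
  derive1 (fun s => hsym [seq x + s | x <- l] k.+1) s =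
  (size l + k)%:R * hsym [seq x + s | x <- l] k.
Proof. by rewrite derive1E; have [_] := is_derive_hsym_shift l k s. Qed.

(** Along the shift [h_{k+1}] is nondecreasing because [h_k >= 0], so it stays nonpositive up to its
    zero [s]; being a multiple of the derivative of [h_{k+2}], it makes [h_{k+2}] decrease until
    then. *)
Lemma hsym_even_stationary l k :
  (forall l', 0 <= hsym l' k) -> 0 < \sum_(x <- l) x -> hsym l k.+1 < 0 ->
  exists s, [/\ 0 <= s, hsym [seq x + s | x <- l] k.+1 = 0 &
    hsym [seq x + s | x <- l] k.+2 <= hsym l k.+2].
Proof.
move=> hk l0 hneg.
(* Shifting by [S] makes all variables nonnegative, which gives the upper end for the intermediate
   value theorem. *)
pose S := \sum_(x <- l) `|x|.
have S0 : 0 <= S by apply: sumr_ge0.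
have hS : 0 <= hsym [seq x + S | x <- l] k.+1.
  apply: hsym_ge0; apply/allP => _ /mapP[x xl ->].
  rewrite /= addrC -lerBlDr sub0r.
  apply: (@le_trans _ _ `|x|); first by rewrite -normrN ler_norm.
  by rewrite /S (big_rem x)//= lerDl sumr_ge0.
have map0 : [seq x + 0 | x <- l] = l.
  by rewrite -[RHS]map_id; apply: eq_map => x; rewrite addr0.
have [s] : exists2 s, s \in `[0, S] & hsym [seq x + s | x <- l] k.+1 = 0.
  apply: (@IVT _ (fun s => hsym [seq x + s | x <- l] k.+1)) => //.
    exact/continuous_subspaceT/hsym_shift_continuous.
  rewrite map0 ge_min le_max hS (ltW hneg) orbT //.
rewrite in_itv /= => /andP[s0 sS] hs; exists s; split=> //.
have mono t : 0 <= t <= s -> hsym [seq x + t | x <- l] k.+1 <= 0.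
  move=> /andP[t0 ts]; rewrite -hs.
  apply: (@ger0_derive1_le_cc _ (fun s => hsym [seq x + s | x <- l] k.+1) 0 s) => //.
  - by move=> y _; have [] := is_derive_hsym_shift l k y.
  - by move=> y _; rewrite hsym_shift_derive1 mulr_ge0.
  - exact/continuous_subspaceT/hsym_shift_continuous.
  - by rewrite in_itv /= t0 ts.
  - by rewrite in_itv /= s0 lexx.
rewrite -[in leRHS]map0.
apply: (@ler0_derive1_le_cc _ (fun s => hsym [seq x + s | x <- l] k.+2) 0 s) => //.
- by move=> y _; have [] := is_derive_hsym_shift l k.+1 y.
- move=> y; rewrite in_itv /= => /andP[y0 ys]; rewrite hsym_shift_derive1.
  by rewrite mulr_ge0_le0// mono// !ltW.
- exact/continuous_subspaceT/hsym_shift_continuous.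
- by rewrite in_itv /= ?lexx s0.
- by rewrite in_itv /= ?lexx s0.
Qed.

(** Euler's identity with one copy of [x] peeled off [h_{k+1} (x :: l)]. For even [k] the last sum
    pairs squares with even-degree values, so it is accessible to induction. *)
Lemma hsym_even_split l k :
  k.+2%:R * hsym l k.+2 =
  (\sum_(x <- l) x) * hsym l k.+1 + \sum_(x <- l) x ^+ 2 * hsym (x :: l) k.
Proof.
rewrite hsym_euler mulr_suml -big_split /=; apply: eq_bigr => x _.
by rewrite hsymS; ring.
Qed.

(* By [hsym_even_split] the induction on [p] works as soon as [\sum x] and [h_{2p-1}]
   do not have opposite signs.  If they do, adding to all variables a constant of the
   sign of [\sum x] until [h_{2p-1}] vanishes increases [\sum x^2] and decreases the
   convex function [h_{2p}]. *)
Lemma hsym_even_ge_norm l p :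
  (\sum_(x <- l) x ^+ 2) ^+ p / (2 ^+ p * p`!%:R) <= hsym l p.*2.
Proof.
have S0 l' : 0 <= \sum_(x <- l') x ^+ 2 by apply: sumr_ge0 => x _; exact: sqr_ge0.
have D0 n : 0 < 2 ^+ n * n`!%:R :> R by rewrite mulr_gt0 ?exprn_gt0 ?ltr0n ?fact_gt0.
elim: p l => [|p IHp] l; first by rewrite hsym0 !expr0 fact0 !mul1r invr1.
have hge0 l' : 0 <= hsym l' p.*2.
  by apply: le_trans (IHp l'); rewrite divr_ge0 ?exprn_ge0// ltW.
have main l' : 0 <= (\sum_(x <- l') x) * hsym l' p.*2.+1 ->
    (\sum_(x <- l') x ^+ 2) ^+ p.+1 / (2 ^+ p.+1 * p.+1`!%:R) <= hsym l' p.+1.*2.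
  move=> h0; rewrite -(ler_pM2l (_ : 0 < p.*2.+2%:R)) ?ltr0n//.
  rewrite doubleS hsym_even_split.
  apply: (@le_trans _ _ (\sum_(x <- l') x ^+ 2 * hsym (x :: l') p.*2)); last first.
    by rewrite lerDr.
  (* The induction hypothesis is applied to [x :: l'], whose sum of squares is at least that of
     [l']. The factor [2p + 2 = 2 (p + 1)] then turns [2 ^ p p!] into the next denominator. *)
  apply: (@le_trans _ _ (\sum_(x <- l') x ^+ 2 *
     ((\sum_(x <- l') x ^+ 2) ^+ p / (2 ^+ p * p`!%:R)))); last first.
    apply: ler_sum => x _; rewrite ler_wpM2l ?sqr_ge0//.
    apply: le_trans (IHp _); rewrite ler_wpM2r ?invr_ge0 ?(ltW (D0 _))//.
    by rewrite lerXn2r ?nnegrE// big_cons lerDr sqr_ge0.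
  rewrite -mulr_suml le_eqVlt; apply/orP; left; apply/eqP.
  rewrite factS natrM !exprS -doubleS -muln2 natrM.
  have n0 : p.+1%:R != 0 :> R by rewrite pnatr_eq0.
  have f0 : p`!%:R != 0 :> R by rewrite pnatr_eq0 -lt0n fact_gt0.
  have e0 : 2 ^+ p != 0 :> R by rewrite expf_neq0.
  move: n0 f0 e0; move: (p.+1%:R) (p`!%:R) (2 ^+ p) => a b' e a0 b0 e0.
  by field; rewrite a0 b0 e0.
have pos l' : 0 < \sum_(x <- l') x ->
    (\sum_(x <- l') x ^+ 2) ^+ p.+1 / (2 ^+ p.+1 * p.+1`!%:R) <= hsym l' p.+1.*2.
  move=> l0; have [h0|h0] := leP 0 (hsym l' p.*2.+1).
    by apply: main; rewrite mulr_ge0// ltW.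
  have [s [s0 hs hle]] := hsym_even_stationary hge0 l0 h0.
  apply: le_trans hle; rewrite -doubleS.
  apply: le_trans (main _ _); last by rewrite hs mulr0.
  rewrite ler_wpM2r ?invr_ge0 ?(ltW (D0 _))// lerXn2r ?nnegrE//.
  rewrite big_map.
  (* The shift by [s >= 0] adds [2 s \sum x] and a sum of squares; the sign of [\sum x] matters
     here. *)
  under [leRHS]eq_bigr do rewrite sqrrD -addrA.
  rewrite big_split /= lerDl big_split /= addr_ge0//.
    by rewrite sumrMnl -mulr_suml mulrn_wge0// mulr_ge0// ltW.
  by apply: sumr_ge0 => x _; exact: sqr_ge0.
have [l0|l0|l0] := ltgtP (\sum_(x <- l) x) 0; last by apply: main; rewrite l0 mul0r.
- have := pos [seq - x | x <- l]; rewrite !big_map hsymN.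
  under [X in X ^+ p.+1]eq_bigr do rewrite sqrrN.
  rewrite -signr_odd odd_double mul1r; apply.
  by rewrite sumrN oppr_gt0.
- exact: pos.
Qed.

Lemma sum_pow_le_pow_sum l p : all (>= 0) l -> (0 < p)%N ->
  \sum_(x <- l) x ^+ p <= (\sum_(x <- l) x) ^+ p.
Proof.
move=> + p0; elim: l => [|x l IHl]; first by rewrite !big_nil expr0n gtn_eqF.
move=> /= /andP[x0 l0]; rewrite !big_cons.
have s0 : 0 <= \sum_(x <- l) x.
  by rewrite big_seq sumr_ge0// => y yl; exact: (allP l0).
apply: le_trans (_ : x ^+ p + (\sum_(x <- l) x) ^+ p <= _).
  by rewrite lerD2l IHl.
case: p p0 {IHl} => // p _; rewrite !exprS mulrDl lerD//.
  by rewrite ler_wpM2l// lerXn2r ?nnegrE ?addr_ge0// lerDl.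
by rewrite ler_wpM2l// lerXn2r ?nnegrE ?addr_ge0// lerDr.
Qed.

(** Hunter's bound, weakened by [\sum y ^ p <= (\sum y) ^ p] at [y = x ^ 2] to involve the power sum
    that occurs in [M]. *)
Lemma hsym_even_ge_power_sum l p : (0 < p)%N ->
  (\sum_(x <- l) x ^+ p.*2) / (2 ^+ p * p`!%:R) <= hsym l p.*2.
Proof.
move=> p0; apply: le_trans (hsym_even_ge_norm l p).
rewrite ler_wpM2r ?invr_ge0 ?mulr_ge0 ?exprn_ge0//.
have := @sum_pow_le_pow_sum [seq x ^+ 2 | x <- l] p.
rewrite !big_map => /(_ _ p0) H.
under eq_bigr do rewrite -mul2n exprM.
by apply: H; apply/allP => _ /mapP[x _ ->]; exact: sqr_ge0.
Qed.

End hsym_real.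

(** * Iterated Lebesgue integrals *)

Section affine_change.
Local Open Scope ereal_scope.
Variable R : realType.
Local Notation mR := (measurableTypeR R).
Local Notation leb := (@lebesgue_measure R).

Lemma measurable_affine (a b : R) :
  measurable_fun [set: mR] (fun x : mR => (a * x + b)%R : mR).
Proof. by apply: measurable_funD => //; exact: mulrl_measurable. Qed.

(** By uniqueness of Lebesgue measure: the pushforward along the affine map, scaled by [|a|], has
    the right value on half-open intervals. *)
Lemma integral_affine (a b : R) (f : mR -> \bar R) : a != 0%R ->
  measurable_fun setT f -> (forall x, 0 <= f x) ->
  \int[leb]_x f (a * x + b)%R = (`|a|^-1)%:E * \int[leb]_x f x.
Proof.
move=> a0 mf f0.
have ma := measurable_affine a b.
pose phi (x : mR) : mR := (a * x + b)%R.
pose nu : {measure set mR -> \bar R} :=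
  measure_function_pushforward__canonical__measure_function_Measure leb (ma : measurable_fun setT phi).
have na0 : (0 <= `|a|)%R by [].
have -> : \int[leb]_x f x = \int[mscale (NngNum na0) nu]_x f x.
  apply: eq_measure_integral => A mA _.
  apply: (lebesgue_measure_unique (mu := mscale (NngNum na0) nu)) => //.
  move=> _ [[u v] _ <-] /=.
  rewrite /mscale /nu /= /pushforward /phi.
  have [uv|vu] := ltP u v; last first.
    rewrite set_itv_ge ?bnd_simp -?leNgt// preimage_set0 !measure0 mule0//.
  rewrite lebesgue_measure_itv /= lte_fin uv.
  have [a_gt0|a_lt0] : (0 < a)%R \/ (a < 0)%R by apply/orP; rewrite orbC -neq_lt.
  - have -> : (fun x : mR => (a * x + b)%R : mR) @^-1` `]u, v] =
        `]((u - b) / a)%R, ((v - b) / a)%R]%classic :> set mR.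
      apply/seteqP; split => x /=; rewrite !in_itv /=.
        by rewrite ltr_pdivrMr// ler_pdivlMr// ltrBlDr lerBrDr ![(x * a)%R]mulrC.
      by rewrite ltr_pdivrMr// ler_pdivlMr// ltrBlDr lerBrDr ![(x * a)%R]mulrC.
    rewrite lebesgue_measure_itv /= lte_fin ltr_pM2r ?invr_gt0// ltrD2r uv.
    rewrite -!EFinB -EFinM gtr0_norm//; congr EFin.
    by field.
  (* For [a < 0] the orientation flips, so the preimage is half-open on the other side. *)
  - have -> : (fun x : mR => (a * x + b)%R : mR) @^-1` `]u, v] =
        `[((v - b) / a)%R, ((u - b) / a)%R[%classic :> set mR.
      apply/seteqP; split => x /=; rewrite !in_itv /=.
        by rewrite ler_ndivrMr// ltr_ndivlMr// ltrBlDr lerBrDr ![(x * a)%R]mulrC andbC.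
      by rewrite ler_ndivrMr// ltr_ndivlMr// ltrBlDr lerBrDr ![(x * a)%R]mulrC andbC.
    rewrite lebesgue_measure_itv /= lte_fin ltr_nM2r ?invr_lt0// ltrD2r uv.
    rewrite -!EFinB -EFinM ltr0_norm//; congr EFin.
    by field.
rewrite ge0_integral_mscale// /nu /= ge0_integral_pushforward//=.
rewrite muleA -EFinM mulVf ?normr_eq0// mul1e.
by rewrite preimage_setT.
Qed.

End affine_change.

Section iter_integral.
Local Open Scope ereal_scope.
Variable R : realType.
Local Notation mR := (measurableTypeR R).
Local Notation leb := (@lebesgue_measure R).
Implicit Types (G H : seq R -> \bar R).

(** Measurability of a function of lists is tested on [n]-tuples. The parameter space [T] collects
    variables already split off, so that inductions on [n] can generalize over it. *)
Definition seq_measurable d (T : measurableType d) n (G : T -> seq R -> \bar R) :=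
  measurable_fun [set: T * n.-tuple mR] (fun p => G p.1 (tval p.2)).

Lemma measurable_nth n i : measurable_fun [set: n.-tuple mR]
  (fun s : n.-tuple mR => nth 0%R (tval s) i : mR).
Proof.
have [ilt|ige] := ltnP i n.
  rewrite (_ : (fun s : n.-tuple mR => _) = @tnth n mR ^~ (Ordinal ilt)).
    exact: measurable_tnth.
  by apply/funext => s; rewrite (tnth_nth 0%R).
rewrite (_ : (fun s : n.-tuple mR => _) = cst (0%R : mR)) //.
by apply/funext => s /=; rewrite nth_default// size_tuple.
Qed.

Lemma measurable_mkseq_comp d (T : measurableType d) n G (f : nat -> T -> R) :
  measurable_fun [set: n.-tuple mR] (fun s => G (tval s)) ->
  (forall j, (j < n)%N -> measurable_fun setT (f j : T -> mR)) ->
  measurable_fun setT (fun p => G (mkseq (f ^~ p) n)).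
Proof.
move=> mG mf.
apply: (@measurableT_comp _ _ _ _ _ _ (fun s : n.-tuple mR => G (tval s)) _
  (fun p => [tuple of mkseq (f ^~ p) n] : n.-tuple mR)) => //.
apply/measurable_fun_tnthP => i.
rewrite (_ : _ \o _ = f i); first exact: mf.
by apply/funext => p; rewrite /= (tnth_nth 0%R) /= nth_mkseq.
Qed.

Lemma seq_measurable_cons d (T : measurableType d) n (G : T -> seq R -> \bar R) :
  seq_measurable n.+1 G ->
  @seq_measurable _ (T * mR)%type n (fun q s => G q.1 (q.2 :: s)).
Proof.
move=> mG.
pose h (q : (T * mR) * n.-tuple mR) := (q.1.1, [the n.+1.-tuple mR of q.1.2 :: q.2]).
apply: (@measurableT_comp _ _ _ _ _ _ _ _ h mG).
apply: measurable_fun_pair => /=; first exact: measurableT_comp.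
by apply: measurable_cons => //; exact: measurableT_comp.
Qed.

Lemma seq_measurable_comp d d' (T : measurableType d) (T' : measurableType d') n
    (G : T -> seq R -> \bar R) (f : T' -> T) :
  measurable_fun setT f -> seq_measurable n G -> seq_measurable n (G \o f).
Proof.
move=> mf mG.
apply: (@measurableT_comp _ _ _ _ _ _ _ _ (fun p : T' * n.-tuple mR => (f p.1, p.2)) mG).
by apply: measurable_fun_pair => //; exact: measurableT_comp.
Qed.

Lemma seq_measurable_section d (T : measurableType d) n (G : T -> seq R -> \bar R) p :
  seq_measurable n G -> measurable_fun [set: n.-tuple mR] (fun s => G p (tval s)).
Proof.
move=> mG.
apply: (@measurableT_comp _ _ _ _ _ _ _ _ (fun s : n.-tuple mR => (p, s)) mG).
exact: measurable_fun_pair.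
Qed.

Lemma seq_measurable_split n G :
  measurable_fun [set: n.+1.-tuple mR] (fun s => G (tval s)) ->
  @seq_measurable _ mR n (fun t s => G (t :: s)).
Proof.
move=> mG.
apply: (@measurableT_comp _ _ _ _ _ _ _ _
  (fun p : mR * n.-tuple mR => [the n.+1.-tuple mR of p.1 :: p.2]) mG).
exact: measurable_cons.
Qed.

Lemma iter_integral_ge0 n G : (forall s, 0 <= G s) -> 0 <= iter_integral n G.
Proof.
elim: n G => [|n IH] G G0 /=; first exact: G0.
by apply: integral_ge0 => t _; exact: IH.
Qed.

Lemma eq_iter_integral n G H : (forall s, size s = n -> G s = H s) ->
  iter_integral n G = iter_integral n H.
Proof.
elim: n G H => [|n IH] G H GH /=; first exact: GH.
by apply: eq_integral => t _; apply: IH => s sn; apply: GH => /=; rewrite sn.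
Qed.

Lemma measurable_iter_integral n d (T : measurableType d) (G : T -> seq R -> \bar R) :
  seq_measurable n G -> (forall p s, 0 <= G p s) ->
  measurable_fun setT (fun p => iter_integral n (G p)).
Proof.
elim: n d T G => [|n IH] d T G mG G0.
  apply: (@measurableT_comp _ _ _ _ _ _ _ _ (fun p : T => (p, [tuple])) mG).
  exact: measurable_fun_pair.
apply: (measurable_fun_fubini_tonelli_F (m2 := leb)
  (fun q : T * mR => iter_integral n (fun s => G q.1 (q.2 :: s)))).
  by apply: (IH _ _ (fun q s => G q.1 (q.2 :: s))) => //; exact: seq_measurable_cons.
by move=> q; exact: iter_integral_ge0.
Qed.

Lemma iter_integralC n (G : mR -> seq R -> \bar R) :
  seq_measurable n G -> (forall t s, 0 <= G t s) ->
  \int[leb]_t iter_integral n (G t) = iter_integral n (fun s => \int[leb]_t G t s).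
Proof.
elim: n G => [//|n IH] G mG G0 /=.
have mc := seq_measurable_cons mG.
rewrite (fubini_tonelli (m1 := leb) (m2 := leb)
  (fun q : mR * mR => iter_integral n (fun s => G q.1 (q.2 :: s)))); last 2 first.
- exact: (measurable_iter_integral (G := fun q : mR * mR => fun s => G q.1 (q.2 :: s))).
- by move=> q; exact: iter_integral_ge0.
apply: eq_integral => u _; apply: (IH (fun t s => G t (u :: s))) => // .
by apply: (seq_measurable_comp (f := fun t : mR => (t, u : mR)) _ mc); exact: measurable_fun_pair.
Qed.

Lemma seq_measurable_integral n (G : mR -> seq R -> \bar R) :
  seq_measurable n G -> (forall t s, 0 <= G t s) ->
  measurable_fun [set: n.-tuple mR] (fun s => \int[leb]_t G t (tval s)).
Proof.
move=> mG G0.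
by apply: (measurable_fun_fubini_tonelli_G (m1 := leb)
  (fun q : mR * n.-tuple mR => G q.1 (tval q.2))).
Qed.

Lemma iter_integralZl n G (k : R) : (0 <= k)%R ->
  measurable_fun [set: n.-tuple mR] (fun s => G (tval s)) -> (forall s, 0 <= G s) ->
  iter_integral n (fun s => k%:E * G s) = k%:E * iter_integral n G.
Proof.
move=> k0; elim: n G => [//|n IH] G mG G0 /=.
have mc := seq_measurable_split mG.
rewrite -ge0_integralZl_EFin//; last 2 first.
- by move=> t _; exact: iter_integral_ge0.
- exact: (measurable_iter_integral (G := fun (t : mR) s => G (t :: s))).
apply: eq_integral => t _; rewrite IH//.
exact: (seq_measurable_section (G := fun (t : mR) s => G (t :: s))).
Qed.

Lemma iter_integralD n G H :
  measurable_fun [set: n.-tuple mR] (fun s => G (tval s)) -> (forall s, 0 <= G s) ->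
  measurable_fun [set: n.-tuple mR] (fun s => H (tval s)) -> (forall s, 0 <= H s) ->
  iter_integral n (fun s => G s + H s) = iter_integral n G + iter_integral n H.
Proof.
elim: n G H => [//|n IH] G H mG G0 mH H0 /=.
have mc := seq_measurable_split mG; have mc' := seq_measurable_split mH.
rewrite -ge0_integralD//; last 4 first.
- by move=> t _; exact: iter_integral_ge0.
- exact: (measurable_iter_integral (G := fun (t : mR) s => G (t :: s))).
- by move=> t _; exact: iter_integral_ge0.
- exact: (measurable_iter_integral (G := fun (t : mR) s => H (t :: s))).
apply: eq_integral => t _; rewrite IH//.
  exact: (seq_measurable_section (G := fun (t : mR) s => G (t :: s))).
exact: (seq_measurable_section (G := fun (t : mR) s => H (t :: s))).
Qed.

End iter_integral.

(** * Affine changes of variables *)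

Section linear_change.
Local Open Scope ereal_scope.
Variable R : realType.
Local Notation mR := (measurableTypeR R).
Local Notation leb := (@lebesgue_measure R).
Implicit Types (G H : seq R -> \bar R).

Lemma mkseqS (T : Type) (f : nat -> T) n : mkseq f n.+1 = f 0%N :: mkseq (f \o S) n.
Proof. by rewrite /mkseq /= -[1%N]addn0 iotaDl -map_comp. Qed.

Lemma measurable_nth_snd d (T : measurableType d) n i :
  measurable_fun [set: T * n.-tuple mR] (fun p => nth 0%R (tval p.2) i : mR).
Proof.
apply: (@measurableT_comp _ _ _ _ _ _ (fun s : n.-tuple mR => nth 0%R (tval s) i : mR) _
  (fun p : T * n.-tuple mR => p.2)); last exact: measurable_snd.
exact: measurable_nth.
Qed.

Lemma measurable_nth_prod d (T : measurableType d) n i (b : R) :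
  measurable_fun [set: T * n.-tuple mR] (fun p => (nth 0 (tval p.2) i * b)%R : mR).
Proof. by apply: measurable_funM => //; exact: measurable_nth_snd. Qed.

(** The coordinates are decoupled, so [integral_affine] applies to one variable at a time. It serves
    for the scaling [k = z] of the cone and, with [k = 1], for translations. *)
Lemma iter_integral_homothety n G (k : R) (e : nat -> R) : (0 < k)%R ->
  measurable_fun [set: n.-tuple mR] (fun s => G (tval s)) -> (forall s, 0 <= G s) ->
  iter_integral n (fun s => G (mkseq (fun j => k * nth 0 s j + e j)%R n)) =
  (k ^- n)%:E * iter_integral n G.
Proof.
move=> k0; elim: n G e => [|n IH] G e mG G0 /=; first by rewrite expr0 invr1 mul1e.
have mc := seq_measurable_split mG.
have mI : measurable_fun [set: mR] (fun t => iter_integral n (fun s => G (t :: s))).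
  exact: (measurable_iter_integral (G := fun (t : mR) s => G (t :: s))).
have I0 t : 0 <= iter_integral n (fun s => G (t :: s)) by exact: iter_integral_ge0.
have kn0 : (0 <= k ^- n)%R by rewrite invr_ge0 exprn_ge0// ltW.
rewrite exprS invfM EFinM -muleA -ge0_integralZl_EFin//.
rewrite -[in X in X%:E * _](gtr0_norm k0) -(integral_affine (e 0%N) (f := fun t =>
  (k ^- n)%:E * iter_integral n (fun s => G (t :: s)))) ?gt_eqF//; last 2 first.
- by apply: emeasurable_funM.
- by move=> t; rewrite mule_ge0// lee_fin invr_ge0 exprn_ge0// ltW.
apply: eq_integral => t _.
rewrite -(IH (fun s => G ((k * t + e 0%N)%R :: s)) (e \o S))//.
  by apply: eq_iter_integral => s _; rewrite mkseqS.
exact: (seq_measurable_section (G := fun (t : mR) s => G (t :: s))).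
Qed.

(** The row-vector map [s |-> e + s B]. Indexing [B] by all of [nat] makes passing to a submatrix a
    mere shift of indices in the induction on [n]. *)
Definition affine_seq n (B : nat -> nat -> R) (e : nat -> R) (s : seq R) : seq R :=
  mkseq (fun j => e j + \sum_(i < n) nth 0 s i * B i j)%R n.

Definition row_injective n (B : nat -> nat -> R) := forall v : nat -> R,
  (forall j, (j < n)%N -> \sum_(i < n) v i * B i j = 0)%R ->
  forall i, (i < n)%N -> v i = 0%R.

Lemma row_injective_col0 n B : row_injective n.+1 B ->
  exists2 k, (k < n.+1)%N & B k 0%N != 0%R.
Proof.
move=> injB.
pose M := (\matrix_(i < n.+1, j < n.+1) B i j)%R.
have : M \in unitmx.
  rewrite -row_free_unit; apply: inj_row_free => v vM.
  apply/rowP => i; rewrite mxE.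
  have := injB (fun i => v ord0 (inord i)) _ i (ltn_ord i).
  rewrite inord_val; apply=> j jn.
  move/rowP/(_ (Ordinal jn)): vM; rewrite !mxE => vMj.
  by rewrite -[RHS]vMj; apply: eq_bigr => a _; rewrite mxE inord_val.
apply: contraPP => /forall2NP B0.
rewrite unitmxE unitfE (expand_det_col _ ord0) big1 ?eqxx// => i _.
rewrite mxE; have [|/negP/negPn/eqP ->] := B0 i; last by rewrite mul0r.
by rewrite ltn_ord.
Qed.

Lemma row_injective_schur n B : B 0%N 0%N != 0%R -> row_injective n.+1 B ->
  row_injective n (fun i j => B i.+1 j.+1 - B i.+1 0%N / B 0%N 0%N * B 0%N j.+1)%R.
Proof.
move=> B00 injB v vC i ilt.
(* The first entry is chosen so that [u] annihilates column 0 of [B]; a kernel vector of the Schur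
   complement thus extends to one of [B]. *)
pose u (i : nat) := if i is i'.+1 then v i' else
  (- (\sum_(i < n) v i * B i.+1 0%N) / B 0%N 0%N)%R.
apply: (injB u _ i.+1 ilt) => -[_|j jn].
  by rewrite big_ord_recl /= divfK ?addNr.
rewrite big_ord_recl /= -[RHS](vC j jn).
under [RHS]eq_bigr do rewrite mulrBr.
rewrite sumrB addrC; congr (_ + _)%R.
rewrite mulNr mulNr; congr (- _)%R; rewrite !mulr_suml.
by apply: eq_bigr => a _; rewrite !mulrA.
Qed.

Lemma seq_measurable_affine n B e G :
  measurable_fun [set: n.+1.-tuple mR] (fun s => G (tval s)) ->
  @seq_measurable _ _ mR n (fun t s => G (affine_seq n.+1 B e (t :: s))).
Proof.
move=> mG; rewrite /seq_measurable.
apply: (@measurable_mkseq_comp _ _ (mR * n.-tuple mR)%type n.+1 G (fun j p =>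
  e j + \sum_(i < n.+1) nth 0 (p.1 :: tval p.2) i * B i j)%R) => // j _.
apply: measurable_funD => //; apply: measurable_sum => -[[|i] ilt] /=.
  by apply: measurable_funM => //; exact: measurable_fst.
exact: measurable_nth_prod.
Qed.

Lemma seq_measurable_section2 n d (T : measurableType d) (G : T -> seq R -> \bar R) s :
  seq_measurable n G -> size s = n -> measurable_fun setT (G ^~ s).
Proof.
move=> mG /eqP sn.
apply: (@measurableT_comp _ _ _ _ _ _ _ _ (fun p : T => (p, Tuple sn : n.-tuple mR)) mG).
exact: measurable_fun_pair.
Qed.

(* Column 0 of [B] can be pivoted on its entry of row 0: the first variable is
   integrated innermost, where it is exchanged for the first output coordinate. *)
Lemma iter_integral_affine_pivot n B : B 0%N 0%N != 0%R ->
  (exists2 K : R, (0 < K)%R & forall e G,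
    measurable_fun [set: n.-tuple mR] (fun s => G (tval s)) -> (forall s, 0 <= G s) ->
    iter_integral n (fun s => G (affine_seq n
      (fun i j => B i.+1 j.+1 - B i.+1 0%N / B 0%N 0%N * B 0%N j.+1)%R e s)) =
    K%:E * iter_integral n G) ->
  exists2 K : R, (0 < K)%R & forall e G,
    measurable_fun [set: n.+1.-tuple mR] (fun s => G (tval s)) -> (forall s, 0 <= G s) ->
    iter_integral n.+1 (fun s => G (affine_seq n.+1 B e s)) = K%:E * iter_integral n.+1 G.
Proof.
move=> B00 [K K0 HK].
exists (`|B 0%N 0%N|^-1 * K)%R; first by rewrite mulr_gt0// invr_gt0 normr_gt0.
move=> e G mG G0.
(* Let [x = B 0 0 * t + b s] be the first output coordinate. Eliminating [t] in favour of [x] leaves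
   the Schur complement [C] acting on [s], with an offset [ex x] that depends on [x] only. *)
pose C (i j : nat) := (B i.+1 j.+1 - B i.+1 0%N / B 0%N 0%N * B 0%N j.+1)%R.
pose ex (x : R) (j : nat) := (e j.+1 + (x - e 0%N) / B 0%N 0%N * B 0%N j.+1)%R.
pose H (x : mR) (s : seq R) := G (x :: affine_seq n C (ex x) s).
have H0 x s : 0 <= H x s by exact: G0.
have mH : seq_measurable n H.
  pose f (j : nat) (p : mR * n.-tuple mR) : R := if j is j'.+1
    then (ex p.1 j' + \sum_(i < n) nth 0 (tval p.2) i * C i j')%R else p.1.
  rewrite /seq_measurable (_ : (fun p => _) = fun p => G (mkseq (f ^~ p) n.+1)); last first.
    by apply/funext => p; rewrite mkseqS.
  apply: measurable_mkseq_comp => // -[_|j _] /=; first exact: measurable_fst.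
  apply: measurable_funD.
    apply: measurable_funD => //; do 2 (apply: measurable_funM => //).
    by apply: measurable_funB => //; exact: measurable_fst.
  by apply: measurable_sum => i; exact: measurable_nth_prod.
pose b (s : seq R) := (e 0%N + \sum_(i < n) nth 0 s i * B i.+1 0%N)%R.
have GH t s : G (affine_seq n.+1 B e (t :: s)) = H (B 0%N 0%N * t + b s)%R s.
  rewrite /H /affine_seq mkseqS; congr (G (_ :: _)).
    by rewrite big_ord_recl /= /b; ring.
  apply: eq_mkseq => j; rewrite /= big_ord_recl /= /ex /C /b.
  under [in RHS]eq_bigr do rewrite mulrBr.
  rewrite sumrB (_ : \sum_(i < n) nth 0 s i * (B i.+1 0%N / B 0%N 0%N * B 0%N j.+1) =
    (\sum_(i < n) nth 0 s i * B i.+1 0%N) / B 0%N 0%N * B 0%N j.+1)%R; last first.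
    by rewrite !mulr_suml; apply: eq_bigr => i _; rewrite !mulrA.
  move: (\sum_(i < n) _)%R (\sum_(i < n) _)%R => X Y.
  by field.
rewrite [LHS]/= iter_integralC//; last exact: seq_measurable_affine.
transitivity (iter_integral n (fun s => (`|B 0%N 0%N|^-1)%:E * \int[leb]_x H x s)).
  apply: eq_iter_integral => s sn.
  under eq_integral do rewrite GH.
  rewrite (integral_affine (b s) (f := fun x => H x s))//.
  exact: (seq_measurable_section2 mH).
rewrite iter_integralZl ?invr_ge0//; last 2 first.
- exact: (seq_measurable_integral mH).
- by move=> s; exact: integral_ge0.
rewrite -iter_integralC// EFinM -muleA; congr (_ * _).
have mc := seq_measurable_split mG.
rewrite /= -ge0_integralZl_EFin//; last 3 first.
- by move=> t _; exact: iter_integral_ge0.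
- exact: (measurable_iter_integral (G := fun (t : mR) s => G (t :: s))).
- exact: ltW.
apply: eq_integral => x _; rewrite -(HK (ex x) (fun s => G (x :: s)))//.
exact: (seq_measurable_section (G := fun (t : mR) s => G (t :: s))).
Qed.

(** Gaussian elimination; [K] stands for [1 / |det B|]. The order of quantifiers matters: one [K]
    serves all offsets and integrands, hence all heights [z] and both relaxations. *)
Lemma iter_integral_affine n B : row_injective n B ->
  exists2 K : R, (0 < K)%R & forall e G,
    measurable_fun [set: n.-tuple mR] (fun s => G (tval s)) -> (forall s, 0 <= G s) ->
    iter_integral n (fun s => G (affine_seq n B e s)) = K%:E * iter_integral n G.
Proof.
elim: n B => [|n IH] B injB; first by exists 1%R => // e G _ _; rewrite mul1e.
have [k kn Bk] := row_injective_col0 injB.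
have [B00|B00] := eqVneq (B 0%N 0%N) 0%R; last first.
  by apply: iter_integral_affine_pivot => //; apply: IH; exact: row_injective_schur.
case: k kn Bk => [|k] kn Bk; first by rewrite B00 eqxx in Bk.
(* Adding row [k.+1] to row 0 creates a nonzero pivot. *)
pose B' (i j : nat) := if i is 0 then (B 0%N j + B k.+1 j)%R else B i j.
have B'00 : B' 0%N 0%N != 0%R by rewrite /B' B00 add0r.
have sumk (c : R) (F : nat -> R) :
    (\sum_(i < n) (c *+ (nat_of_ord i == k)) * F i = c * F k)%R.
  rewrite (bigD1 (Ordinal (kn : k < n)%N))//= eqxx mulr1n big1 ?addr0// => i ik.
  by rewrite (_ : (nat_of_ord i == k) = false) ?mulr0n ?mul0r//; apply: negbTE.
have injB' : row_injective n.+1 B'.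
  move=> v vB'.
  pose u (i : nat) := if i is i'.+1 then (v i + v 0%N *+ (i' == k))%R else v 0%N.
  have u0 : forall i, (i < n.+1)%N -> u i = 0%R.
    apply: injB => j jn; rewrite -[RHS](vB' j jn) !big_ord_recl /=.
    under eq_bigr do rewrite mulrDl.
    rewrite big_split /= (sumk _ (fun i => B i.+1 j)) mulrDr -!addrA; congr (_ + _)%R.
    by rewrite addrC.
  move=> [|i] ilt; first exact: (u0 0%N).
  by have := u0 _ ilt; rewrite /= (u0 0%N erefl : v 0%N = 0%R) mul0rn addr0.
have [K K0 HK] := iter_integral_affine_pivot B'00 (IH _ (row_injective_schur B'00 injB')).
exists K => // e G mG G0; rewrite -(HK e)//=.
apply: eq_integral => t _.
have mt := seq_measurable_section t (seq_measurable_affine B e mG).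
(* For fixed [t], the row operation amounts to translating the inner variable of index [k] by [t],
   which leaves the inner integral unchanged. *)
have := @iter_integral_homothety n (fun s => G (affine_seq n.+1 B e (t :: s))) 1%R
  (fun j => t *+ (j == k))%R ltr01 mt.
rewrite expr1n invr1 mul1e => <-//.
apply: eq_iter_integral => s sn; congr G; apply: eq_mkseq => j.
congr (_ + _)%R; rewrite !big_ord_recl /= mulrDr -addrA; congr (_ + _)%R.
rewrite -(sumk t (fun i => B i.+1 j)) -big_split /=; apply: eq_bigr => i _.
by rewrite add0n nth_mkseq// mul1r mulrDl addrC.
Qed.

End linear_change.

(** * Power integrals over a simplex *)

Section simplex_integral.
Variable R : realType.
Local Notation mR := (measurableTypeR R).
Local Notation leb := (@lebesgue_measure R).

Lemma integral_deriv_poly (p : {poly R}) (a b : R) : a <= b ->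
  (\int[leb]_(x in `[a, b]) (p^`().[x])%:E = (p.[b] - p.[a])%:E)%E.
Proof.
rewrite le_eqVlt => /predU1P[->|ab].
  by rewrite set_itv1 integral_set1 subrr.
rewrite (@continuous_FTC2 _ (horner p^`()) (horner p))//.
- by apply: continuous_subspaceT; exact: continuous_horner.
- split.
  + by move=> x _; have [] := is_derive_poly p x.
  + by apply: cvg_at_right_filter; exact: continuous_horner.
  + by apply: cvg_at_left_filter; exact: continuous_horner.
- by move=> x _; rewrite derive1E; have [_] := is_derive_poly p x.
Qed.

(** This is [binom(q, j)], from the expansion in [A], times the factor [j! / (j + d)!] of the
    Dirichlet integral in degree [j]. *)
Definition simplex_coef (d q j : nat) : R := q`!%:R / ((q - j)`!%:R * (j + d)`!%:R).

(* The integral of [(A + l(u))^q] over the [d]-simplex of size [r], for [l] the linear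
   interpolation of [L] on its barycentric coordinates: expand in powers of [A]. *)
Definition simplex_moment (q d : nat) (A r : R) (L : seq R) : R :=
  \sum_(j < q.+1) simplex_coef d q j * hsym L j * A ^+ (q - j) * r ^+ (j + d).

Definition simplex_moment_poly (q d : nat) (A w r : R) (L : seq R) : {poly R} :=
  \sum_(j < q.+1) (simplex_coef d q j * hsym L j)%:P *
    (A%:P + w%:P * 'X) ^+ (q - j) * (r%:P - 'X) ^+ (j + d).

Lemma horner_simplex_moment q d A w r L t :
  (simplex_moment_poly q d A w r L).[t] = simplex_moment q d (A + w * t) (r - t) L.
Proof.
rewrite /simplex_moment_poly /simplex_moment horner_sum; apply: eq_bigr => j _.
by rewrite !hornerE.
Qed.

Lemma fact_neq0 n : n`!%:R != 0 :> R.
Proof. by rewrite pnatr_eq0 -lt0n fact_gt0. Qed.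

(** This identity and the next absorb the exponents produced by differentiating
    [(r - t) ^ (j + d.+1)] and [(A + w t) ^ (q - j)]. *)
Lemma simplex_coefSr d q j :
  simplex_coef d.+1 q j * (j + d.+1)%:R = simplex_coef d q j.
Proof.
rewrite /simplex_coef addnS factS natrM.
have := fact_neq0 (q - j); have := fact_neq0 (j + d).
have : (j + d).+1%:R != 0 :> R by rewrite pnatr_eq0.
move: (_.+1%:R) (_`!%:R) (_`!%:R) (_`!%:R) => x y z u x0 y0 z0.
by field; rewrite x0 y0 z0.
Qed.

Lemma simplex_coefS d q j : (j < q)%N ->
  simplex_coef d.+1 q j * (q - j)%:R = simplex_coef d q j.+1.
Proof.
move=> jq; rewrite /simplex_coef addnS addSn -(subnSK jq) [(q - j.+1).+1`!]factS natrM.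
have := fact_neq0 (q - j.+1); have := fact_neq0 (j + d).+1.
have : (q - j.+1).+1%:R != 0 :> R by rewrite pnatr_eq0.
move: (_.+1%:R) (_`!%:R) (_`!%:R) (_`!%:R) => x y z u x0 y0 z0.
by field; rewrite x0 y0 z0.
Qed.

(* Integrating out one variable [t] of the simplex replaces [(A, r)] by
   [(A + w t, r - t)]; the moment itself is the antiderivative, because
   [h_j (w :: L) - w h_{j-1} (w :: L) = h_j L]. *)
Lemma deriv_simplex_moment q d A w r L :
  (simplex_moment_poly q d.+1 A w r (w :: L))^`() = - simplex_moment_poly q d A w r L.
Proof.
rewrite /simplex_moment_poly.
set X := A%:P + w%:P * 'X; set Y := r%:P - 'X.
have dX : X^`() = w%:P by rewrite derivD derivC derivM derivC derivX mul0r !add0r mulr1.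
have dY : Y^`() = - 1 by rewrite derivB derivC derivX sub0r.
(* [T1] comes from differentiating the powers of [Y], [T2] from those of [X]. [T2 j] carries the
   same powers as [T1 j.+1], so the two sums combine after a shift of index. *)
pose T1 (j : nat) := (simplex_coef d q j * hsym (w :: L) j)%:P * X ^+ (q - j) * Y ^+ (j + d).
pose T2 (j : nat) := (simplex_coef d q j.+1 * w * hsym (w :: L) j)%:P *
   X ^+ (q - j.+1) * Y ^+ (j.+1 + d).
have -> : (\sum_(j < q.+1) (simplex_coef d.+1 q j * hsym (w :: L) j)%:P *
    X ^+ (q - j) * Y ^+ (j + d.+1))^`() = \sum_(j < q) T2 j - \sum_(j < q.+1) T1 j.
  rewrite raddf_sum /= big_ord_recr /= [in RHS]big_ord_recr /= opprD addrA -sumrB.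
  have dT1 j : (simplex_coef d.+1 q j * hsym (w :: L) j)%:P * X ^+ (q - j) *
      (Y ^+ (j + d.+1))^`() = - T1 j.
    rewrite deriv_exp dY -mulr_natr addnS /= /T1 -(simplex_coefSr d q j) addnS.
    rewrite !polyCM polyC_natr; ring.
  congr (_ + _); last first.
    by rewrite derivM dT1 derivM derivC mul0r add0r subnn expr0 derivC mulr0 mul0r add0r.
  apply: eq_bigr => j _; rewrite derivM dT1; congr (_ - _).
  rewrite derivM derivC mul0r add0r deriv_exp dX -mulr_natr /T2 -simplex_coefS//.
  rewrite subnS addSn addnS !polyCM polyC_natr; ring.
rewrite big_ord_recl [in RHS]big_ord_recl /= !opprD addrCA; congr (_ + _).
  by rewrite /T1 !hsym0.
rewrite -sumrB -sumrN; apply: eq_bigr => j _.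
rewrite /T1 /T2 /= /bump /= add1n hsymS !(polyCM, polyCD); ring.
Qed.

Lemma simplex_moment_r0 q d A L : simplex_moment q d.+1 A 0 L = 0.
Proof. by rewrite /simplex_moment big1// => j _; rewrite addnS expr0n mulr0. Qed.

Definition in_simplex (r : R) (s : seq R) := all (>= 0) s && (\sum_(x <- s) x <= r).

Definition dot_seq (l s : seq R) : R := \sum_(p <- zip l s) p.1 * p.2.

Lemma iter_integral0 n : iter_integral n (fun=> 0%E) = 0%E :> \bar R.
Proof. by elim: n => //= n IH; rewrite IH integral0. Qed.

Lemma hsym_seq1 (w : R) j : hsym [:: w] j = w ^+ j.
Proof. by elim: j => // j IH; rewrite hsymS IH exprS /hsym /= add0r. Qed.

Lemma simplex_integral q w0 l A r : 0 <= r ->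
  iter_integral (size l) (fun s => (if in_simplex r s then
    (A + (r - \sum_(x <- s) x) * w0 + dot_seq l s) ^+ q else 0)%:E) =
  (simplex_moment q (size l) A r (rcons l w0))%:E.
Proof.
elim: l A r => [|w l IH] A r r0 /=.
  (* With no variable left the claim is the binomial formula for [(A + r w0) ^ q]. *)
  rewrite /in_simplex /dot_seq !big_nil /= r0 subr0 addr0 exprDn; congr EFin.
  apply: eq_bigr => j _; rewrite hsym_seq1 addn0 exprMn /simplex_coef addn0.
  have jq : (j <= q)%N by rewrite -ltnS.
  rewrite -mulr_natl -(bin_fact jq) !natrM.
  by field; rewrite !fact_neq0.
transitivity (\int[leb]_(t in `[0%R, r])
    ((- simplex_moment_poly q (size l).+1 A w r (w :: rcons l w0))^`().[t])%:E)%E.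
  rewrite [RHS]integral_mkcond; apply: eq_integral => t _; rewrite patchE.
  have [|tnr] := boolP (t \in _).
    rewrite inE /= in_itv /= => /andP[t0 tr].
    rewrite derivN deriv_simplex_moment opprK horner_simplex_moment -IH ?subr_ge0//.
    apply: eq_iter_integral => s _; congr EFin.
    rewrite /in_simplex /dot_seq /= !big_cons t0 /= [X in _ && (X <= r)]addrC -lerBrDr.
    by case: ifP => // _; congr (_ ^+ q); rewrite opprD /=; ring.
  transitivity (iter_integral (size l) (fun=> 0%E : \bar R)); last exact: iter_integral0.
  apply: eq_iter_integral => s _; congr EFin.
  case: ifP => // /andP[/=/andP[t0 s0]]; rewrite big_cons => ts; move: tnr.
  rewrite notin_setE /= in_itv /= t0 /= => /negP; rewrite -ltNge => rt.
  have : 0 <= \sum_(x <- s) x.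
    by rewrite big_seq sumr_ge0// => y ys; exact: (allP s0).
  by lra.
rewrite integral_deriv_poly// !hornerN !horner_simplex_moment subrr simplex_moment_r0.
by rewrite oppr0 sub0r opprK mulr0 !addr0.
Qed.

(** At [A = 0] only the top term [j = q] survives; this is where [h_q] of the vertex values enters
    the volumes. *)
Lemma simplex_integral_homogeneous q w0 l :
  iter_integral (size l) (fun s => (if in_simplex 1 s then
    ((1 - \sum_(x <- s) x) * w0 + dot_seq l s) ^+ q else 0)%:E) =
  (q`!%:R / (q + size l)`!%:R * hsym (rcons l w0) q)%:E.
Proof.
have := simplex_integral q w0 l 0 ler01.
rewrite /simplex_moment big_ord_recr /= subnn expr0 expr1n !mulr1 big1; last first.
  by move=> j _; rewrite expr0n subn_eq0 leqNgt ltn_ord /= mulr0 mul0r.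
rewrite add0r /simplex_coef subnn fact0 mul1r => <-.
by apply: eq_iter_integral => s _; rewrite add0r.
Qed.

End simplex_integral.

(** * Volumes as iterated integrals *)

Section volume.
Local Open Scope ereal_scope.
Variable R : realType.
Local Notation mR := (measurableTypeR R).
Local Notation leb := (@lebesgue_measure R).

Lemma iter_integral_cat2 n (G : seq R -> \bar R) :
  iter_integral n.+2 G =
  iter_integral n (fun s => \int[leb]_y \int[leb]_z G (s ++ [:: y; z])).
Proof.
elim: n G => [//|n IH] G.
by apply: eq_integral => t _; exact: (IH (fun s => G (t :: s))).
Qed.

Definition seq_point (d : nat) (s : seq R) (y z : R) : 'rV[R]_d * R * R :=
  ((\row_(j < d) nth 0 s j)%R, y, z).

Lemma volE d (A : set ('rV[R]_d * R * R)) :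
  vol A = iter_integral d (fun s =>
    \int[leb]_y \int[leb]_z (\1_A (seq_point d s y z))%:E).
Proof.
rewrite /vol iter_integral_cat2; apply: eq_iter_integral => s sd.
apply: eq_integral => y _; apply: eq_integral => z _.
congr ((\1_A _)%:E); rewrite /point_of /seq_point.
have -> : nth 0%R (s ++ [:: y; z]) d = y by rewrite nth_cat sd ltnn subnn.
have -> : nth 0%R (s ++ [:: y; z]) d.+1 = z.
  by rewrite nth_cat sd ltnNge leqnSn /= subSnn.
congr (_, _, _); apply/rowP => j; rewrite !mxE nth_cat sd ltn_ord //.
Qed.

(** The grouping [((z, s), y)] matches the order of integration in [volE_zxy]: [y] innermost, [z]
    outermost, so that slices at fixed [z] are scaled copies of one simplex region. *)
Definition measurable_region d (A : set ('rV[R]_d * R * R)) :=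
  measurable_fun [set: (mR * d.-tuple mR) * mR]
    (fun p => \1_A (seq_point d (tval p.1.2) p.2 p.1.1) : mR).

Lemma measurable_region_section d (A : set ('rV[R]_d * R * R)) s :
  measurable_region A -> size s = d ->
  measurable_fun [set: mR * mR] (fun p => \1_A (seq_point d s p.1 p.2) : mR).
Proof.
move=> mA /eqP sd.
apply: (@measurableT_comp _ _ _ _ _ _ _ _
  (fun p : mR * mR => ((p.2, Tuple sd : d.-tuple mR), p.1)) mA).
by apply: measurable_fun_pair => //; apply: measurable_fun_pair.
Qed.

Lemma volE_zxy d (A : set ('rV[R]_d * R * R)) : measurable_region A ->
  vol A = \int[leb]_z iter_integral d (fun s =>
    \int[leb]_y (\1_A (seq_point d s y z))%:E).
Proof.
move=> mA; have mA' := (measurable_EFinP _ _).2 mA.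
rewrite volE iter_integralC; last 2 first.
- by apply: (measurable_fun_fubini_tonelli_F (m2 := leb)
    (fun p : (mR * d.-tuple mR) * mR => (\1_A (seq_point d (tval p.1.2) p.2 p.1.1))%:E)).
- by move=> z s; apply: integral_ge0 => y _; rewrite lee_fin.
apply: eq_iter_integral => s sd.
apply: (fubini_tonelli (m1 := leb) (m2 := leb)
  (fun p : mR * mR => (\1_A (seq_point d s p.1 p.2))%:E)).
  exact: ((measurable_EFinP _ _).2 (measurable_region_section mA sd)).
by move=> p; rewrite lee_fin.
Qed.

(** The integral over [z] ignores one point, and measurability is asked of [A'] alone. The closure
    in [persp_relax] thus never has to be described at [z = 0]. *)
Lemma vol_eq_z0 d (A A' : set ('rV[R]_d * R * R)) : measurable_region A' ->
  (forall x y z, z != 0%R -> A (x, y, z) <-> A' (x, y, z)) -> vol A = vol A'.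
Proof.
move=> mA' AA'; rewrite !volE; apply: eq_iter_integral => s sd.
apply: eq_integral => y _.
have eqz z : z != 0%R -> \1_A (seq_point d s y z) = \1_A' (seq_point d s y z) :> R.
  move=> z0; rewrite !indicE; congr (_%:R); congr nat_of_bool.
  by apply/idP/idP; rewrite !inE => /AA'; exact.
have mA'y : measurable_fun [set: mR] (fun z : mR => (\1_A' (seq_point d s y z))%:E : \bar R).
  have mAy : measurable_fun [set: mR] (fun z : mR => \1_A' (seq_point d s y z) : mR);
    last exact: ((measurable_EFinP _ _).2 mAy).
  apply: (@measurableT_comp _ _ _ _ _ _ _ _ (fun z : mR => (y : mR, z))
    (measurable_region_section mA' sd)).
  exact: measurable_fun_pair.
have mset : measurable ([set: mR] `\ 0%R) by exact: measurableD.
have mA'y0 := measurable_funS measurableT (@subsetT _ ([set: mR] `\ 0%R)) mA'y.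
rewrite -(@integral_setD1 _ _ 0%R setT)//; last first.
  apply: eq_measurable_fun mA'y0 => z; rewrite inE /= => -[_ /eqP z0].
  by rewrite eqz.
rewrite -(@integral_setD1 _ (fun z => (\1_A' (seq_point d s y z))%:E) 0%R setT)//.
by apply: eq_integral => z; rewrite inE /= => -[_ /eqP z0]; rewrite eqz.
Qed.

End volume.

(** * The cone over a simplex *)

Section jensen.
Variable R : realType.

Lemma tangent_le_pow (p : nat) (t m : R) : 0 <= t -> 0 <= m ->
  m ^+ p.+1 + p.+1%:R * m ^+ p * (t - m) <= t ^+ p.+1.
Proof.
move=> t0 m0; elim: p => [|p IH]; first by rewrite !expr1 expr0; lra.
apply: le_trans (_ : t * (m ^+ p.+1 + p.+1%:R * m ^+ p * (t - m)) <= _); last first.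
  by rewrite [t ^+ p.+2]exprS ler_wpM2l.
rewrite -subr_ge0 -[p.+2%:R]natr1 !exprS.
have -> : t * (m * m ^+ p + p.+1%:R * m ^+ p * (t - m)) -
    (m * (m * m ^+ p) + (p.+1%:R + 1) * (m * m ^+ p) * (t - m)) =
    p.+1%:R * m ^+ p * (t - m) ^+ 2 by ring.
by rewrite mulr_ge0 ?sqr_ge0// mulr_ge0 ?exprn_ge0.
Qed.

Lemma jensen_pow_ge0 n p (lam x : 'I_n -> R) :
  (forall i, 0 <= lam i) -> \sum_i lam i = 1 -> (forall i, 0 <= x i) ->
  (\sum_i lam i * x i) ^+ p <= \sum_i lam i * x i ^+ p.
Proof.
move=> lam0 lam1 x0; case: p => [|p].
  by rewrite expr0; under eq_bigr do rewrite expr0 mulr1; rewrite lam1.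
set m := \sum_i lam i * x i.
have m0 : 0 <= m by apply: sumr_ge0 => i _; exact: mulr_ge0.
apply: le_trans (_ : \sum_i lam i * (m ^+ p.+1 + p.+1%:R * m ^+ p * (x i - m)) <= _).
  rewrite le_eqVlt; apply/orP; left; apply/eqP.
  under eq_bigr do rewrite mulrDr mulrCA mulrBr.
  by rewrite big_split /= -mulr_suml lam1 mul1r -mulr_sumr sumrB -mulr_suml lam1 mul1r subrr mulr0 addr0.
by apply: ler_sum => i _; rewrite ler_wpM2l// tangent_le_pow.
Qed.

(** The [x i] may be negative, so the square is treated first, through nonnegativity of the
    variance; Jensen for nonnegative numbers is then applied to the [x i ^+ 2]. *)
Lemma jensen_even n q (lam x : 'I_n -> R) : ~~ odd q ->
  (forall i, 0 <= lam i) -> \sum_i lam i = 1 ->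
  (\sum_i lam i * x i) ^+ q <= \sum_i lam i * x i ^+ q.
Proof.
move=> qeven lam0 lam1; rewrite -(even_halfK qeven) -mul2n exprM.
under [leRHS]eq_bigr do rewrite exprM.
apply: le_trans (jensen_pow_ge0 _ lam0 lam1 (fun i => sqr_ge0 _)).
rewrite lerXn2r ?nnegrE ?sqr_ge0//.
  by apply: sumr_ge0 => i _; rewrite mulr_ge0// sqr_ge0.
set m := \sum_i lam i * x i; rewrite -subr_ge0.
have -> : \sum_i lam i * x i ^+ 2 - m ^+ 2 = \sum_i lam i * (x i - m) ^+ 2.
  transitivity (\sum_i (lam i * x i ^+ 2 - (2 * m) * (lam i * x i) + lam i * m ^+ 2)).
    rewrite big_split /= sumrB -mulr_sumr -mulr_suml lam1 -/m; ring.
  by apply: eq_bigr => i _; ring.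
by apply: sumr_ge0 => i _; rewrite mulr_ge0// sqr_ge0.
Qed.

End jensen.

Section simplex_geometry.
Variables (R : realType) (d : nat) (v : 'I_d.+1 -> 'rV[R]_d).
Hypothesis v_free : affinely_independent v.

Definition edge_mx : 'M[R]_d := \matrix_(i < d) (v (lift ord0 i) - v ord0).

Lemma edge_mx_unit : edge_mx \in unitmx.
Proof. by rewrite -row_free_unit. Qed.

(* For [z > 0], [z^-1 *: simplex_coord x z] are the barycentric coordinates of
   [z^-1 *: x] at the vertices other than [v ord0]. *)
Definition simplex_coord (x : 'rV[R]_d) (z : R) : 'rV[R]_d :=
  (x - z *: v ord0) *m invmx edge_mx.

(** Membership of [x] in [z.J] as finitely many linear inequalities in [(x, z)], from which
    measurability and closedness can be read off. *)
Definition in_cone (x : 'rV[R]_d) (z : R) : bool :=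
  [forall j, 0 <= simplex_coord x z 0 j] && (\sum_j simplex_coord x z 0 j <= z).

Lemma simplex_coordK (u : 'rV[R]_d) z :
  simplex_coord (z *: v ord0 + u *m edge_mx) z = u.
Proof. by rewrite /simplex_coord addrC addKr mulmxK// edge_mx_unit. Qed.

Lemma mul_edge_mx (u : 'rV[R]_d) :
  u *m edge_mx = \sum_j u 0 j *: (v (lift ord0 j) - v ord0).
Proof. by rewrite mulmx_sum_row; apply: eq_bigr => j _; rewrite rowK. Qed.

Lemma simplex_coord_mul (x : 'rV[R]_d) z :
  x = z *: v ord0 + simplex_coord x z *m edge_mx.
Proof. by rewrite /simplex_coord mulmxKV ?edge_mx_unit// addrC subrK. Qed.

Lemma barycenter_edge (lam : 'I_d.+1 -> R) (u : 'rV[R]_d) z :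
  (forall j, u 0 j = z * lam (lift ord0 j)) -> \sum_i lam i = 1 ->
  z *: (\sum_i lam i *: v i) = z *: v ord0 + u *m edge_mx.
Proof.
move=> uE lam1; rewrite mul_edge_mx.
under [in RHS]eq_bigr do rewrite uE -scalerA.
rewrite -scaler_sumr -scalerDr; congr (_ *: _).
under [in RHS]eq_bigr do rewrite scalerBr.
rewrite sumrB -scaler_suml big_ord_recl.
have -> : lam ord0 = 1 - \sum_(i < d) lam (lift ord0 i).
  by rewrite -lam1 big_ord_recl addrK.
by rewrite scalerBl scale1r addrAC addrA.
Qed.

Lemma scale_conv_hullP (x : 'rV[R]_d) z : 0 <= z ->
  scale_set z (conv_hull v) x <-> in_cone x z.
Proof.
move=> z0; split.
  move=> [_ [lam [lam0 [lam1 ->]]] <-].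
  rewrite (barycenter_edge (u := \row_j (z * lam (lift ord0 j))))//; last first.
    by move=> j; rewrite mxE.
  rewrite /in_cone simplex_coordK; apply/andP; split.
    by apply/forallP => j; rewrite mxE mulr_ge0.
  under eq_bigr do rewrite mxE.
  rewrite -mulr_sumr -[leRHS]mulr1 ler_wpM2l// -lam1 big_ord_recl lerDr//.
move=> /andP[/forallP u0 uz].
move: z0; rewrite le_eqVlt => /predU1P[z0|z0].
  (* At [z = 0] the coordinates are nonnegative with sum at most 0, so [x = 0] and any point of [J],
     here a vertex, is a witness. *)
  exists (v ord0).
    exists (fun i => (i == ord0)%:R); split; first by move=> i; rewrite ler0n.
    split; rewrite (bigD1 ord0)//= ?eqxx ?scale1r big1 ?addr0//.
      by move=> i /negPf ->.
    by move=> i /negPf ->; rewrite scale0r.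
  have u0' j : simplex_coord x z 0 j = 0.
    have S0 : \sum_j simplex_coord x z 0 j = 0.
      apply/eqP; rewrite eq_le; apply/andP; split; first by rewrite [leRHS]z0.
      by apply: sumr_ge0 => k _; exact: u0.
    exact: (psumr_eq0P (fun j _ => u0 j) S0).
  rewrite [RHS](simplex_coord_mul x z) mul_edge_mx big1 ?addr0// => j _.
  by rewrite u0' scale0r.
pose lam (i : 'I_d.+1) := if unlift ord0 i is Some j then z^-1 * simplex_coord x z 0 j
  else 1 - z^-1 * \sum_j simplex_coord x z 0 j.
have lam_lift j : lam (lift ord0 j) = z^-1 * simplex_coord x z 0 j by rewrite /lam liftK.
have lam_0 : lam ord0 = 1 - z^-1 * \sum_j simplex_coord x z 0 j.
  by rewrite /lam unlift_none.
have lam1 : \sum_i lam i = 1.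
  rewrite big_ord_recl; under eq_bigr do rewrite lam_lift.
  by rewrite lam_0 -mulr_sumr subrK.
exists (\sum_i lam i *: v i).
  exists lam; split=> // i; case: (unliftP ord0 i) => [j ->|->].
    by rewrite lam_lift mulr_ge0// invr_ge0 ltW.
  by rewrite lam_0 subr_ge0 mulrC ler_pdivrMr// mul1r.
rewrite [RHS](simplex_coord_mul x z); apply: barycenter_edge => // j.
by rewrite lam_lift mulVKf// gt_eqF.
Qed.

Lemma dotp_is_linear (g : 'rV[R]_d) : linear_for *%R (dotp g).
Proof.
move=> k x y; rewrite /dotp mulr_sumr -big_split /=; apply: eq_bigr => j _.
by rewrite !mxE; ring.
Qed.
HB.instance Definition _ (g : 'rV[R]_d) :=
  GRing.isLinear.Build R 'rV[R]_d R *%R (dotp g) (dotp_is_linear g).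

(** Used for [mu] itself and, with [h = 0], for the linear form [dotp c]. *)
Lemma mu_hom_cone (g : 'rV[R]_d) (h : R) (om : 'I_d.+1 -> R) (u : 'rV[R]_d) z :
  (forall i, dotp g (v i) + h = om i) ->
  mu_hom g h (z *: v ord0 + u *m edge_mx) z =
  (z - \sum_j u 0 j) * om ord0 + \sum_j u 0 j * om (lift ord0 j).
Proof.
move=> gh; rewrite /mu_hom linearD linearZ /= mul_edge_mx linear_sum /=.
under eq_bigr do rewrite linearZ /= linearB /=.
have -> : \sum_(i < d) u 0 i * (dotp g (v (lift ord0 i)) - dotp g (v ord0)) =
   \sum_(i < d) u 0 i * dotp g (v (lift ord0 i)) - (\sum_i u 0 i) * dotp g (v ord0).
  by rewrite mulr_suml -sumrB; apply: eq_bigr => i _; rewrite mulrBr.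
have -> : \sum_(j < d) u 0 j * om (lift ord0 j) =
   \sum_(i < d) u 0 i * dotp g (v (lift ord0 i)) + (\sum_i u 0 i) * h.
  by rewrite mulr_suml -big_split; apply: eq_bigr => i _; rewrite -gh mulrDr.
by rewrite -gh; ring.
Qed.

End simplex_geometry.

Section row_sequences.
Variables (R : realType) (d : nat).
Local Notation mR := (measurableTypeR R).

Definition mx_entry (M : 'M[R]_d) (i j : nat) : R :=
  match insub i, insub j with Some i', Some j' => M i' j' | _, _ => 0 end.

Definition row_entry (x : 'rV[R]_d) (j : nat) : R :=
  if insub j is Some j' then x 0 j' else 0.

Lemma mx_entryE (M : 'M[R]_d) (i j : 'I_d) : mx_entry M i j = M i j.
Proof. by rewrite /mx_entry !valK. Qed.

Lemma row_entryE (x : 'rV[R]_d) (j : 'I_d) : row_entry x j = x 0 j.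
Proof. by rewrite /row_entry valK. Qed.

Lemma row_affine_seq (M : 'M[R]_d) (x : 'rV[R]_d) s :
  \row_(j < d) nth 0 (affine_seq d (mx_entry M) (row_entry x) s) j =
  x + (\row_(j < d) nth 0 s j) *m M.
Proof.
apply/rowP => j; rewrite !mxE nth_mkseq// row_entryE; congr (_ + _).
by apply: eq_bigr => i _; rewrite mxE mx_entryE.
Qed.

Lemma row_injective_unitmx (M : 'M[R]_d) : M \in unitmx -> row_injective d (mx_entry M).
Proof.
move=> Mu w wM i ilt.
have : (\row_(i < d) w i) *m M = 0.
  apply/rowP => j; rewrite !mxE -[RHS](wM j (ltn_ord j)).
  by apply: eq_bigr => k _; rewrite mxE mx_entryE.
move=> /(congr1 (mulmx ^~ (invmx M))); rewrite mulmxK// mul0mx.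
by move=> /rowP/(_ (Ordinal ilt)); rewrite !mxE.
Qed.

Lemma sum_seq_ord (s : seq R) : size s = d ->
  \sum_(x <- s) x = \sum_(j < d) nth 0 s j.
Proof. by move=> <-; rewrite (big_nth 0) big_mkord. Qed.

Lemma dot_seq_mkseq (F : nat -> R) (s : seq R) : size s = d ->
  dot_seq (mkseq F d) s = \sum_(j < d) nth 0 s j * F j.
Proof.
move=> sd; rewrite /dot_seq (big_nth (0, 0)) size_zip size_mkseq sd minnn big_mkord.
apply: eq_bigr => j _; rewrite nth_zip ?size_mkseq ?sd//= nth_mkseq//.
by rewrite mulrC.
Qed.

Lemma in_simplex_forall (r : R) (s : seq R) : size s = d ->
  in_simplex r s = [forall j : 'I_d, 0 <= nth 0 s j] && (\sum_(j < d) nth 0 s j <= r).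
Proof.
move=> sd; rewrite /in_simplex sum_seq_ord//; congr (_ && _).
apply/idP/idP.
  by move=> /allP s0; apply/forallP => j; apply: s0; rewrite mem_nth// sd.
move=> /forallP s0; apply/allP => x /(nthP 0)[j]; rewrite sd => jd <-.
exact: (s0 (Ordinal jd)).
Qed.

Lemma measurable_forall dT (T : measurableType dT) (I : finType) (P : I -> T -> bool) :
  (forall i, measurable_fun setT (P i)) ->
  measurable_fun setT (fun p => [forall i, P i p]).
Proof.
move=> mP; rewrite (_ : (fun p => _) = fun p => all (P^~ p) (enum I)); last first.
  apply/funext => p; apply/idP/idP.
    by move=> /forallP h; apply/allP => i _.
  by move=> /allP h; apply/forallP => i; apply: h; rewrite mem_enum.
elim: (enum I) => [|i l IH] /=; first exact: measurable_cst.
exact: measurable_and.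
Qed.

Lemma measurable_in_simplex_poly q w0 (F : nat -> R) (r : R) :
  measurable_fun [set: d.-tuple mR] (fun s => (if in_simplex r (tval s) then
    ((r - \sum_(x <- tval s) x) * w0 + dot_seq (mkseq F d) (tval s)) ^+ q else 0)%:E).
Proof.
have msum : measurable_fun [set: d.-tuple mR] (fun s => \sum_(j < d) nth 0 (tval s) j : mR).
  by apply: measurable_sum => j; exact: measurable_nth.
have H : measurable_fun [set: d.-tuple mR] (fun s : d.-tuple mR =>
  (if [forall j : 'I_d, 0 <= nth 0 (tval s) j] && (\sum_(j < d) nth 0 (tval s) j <= r) then
    ((r - \sum_(j < d) nth 0 (tval s) j) * w0 + \sum_(j < d) nth 0 (tval s) j * F j) ^+ q
   else 0) : mR).
  apply: measurable_fun_ifT => //.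
    apply: measurable_and.
      by apply: measurable_forall => j; apply: measurable_fun_ler => //; exact: measurable_nth.
    exact: measurable_fun_ler.
  apply: measurable_funX; apply: measurable_funD.
    by apply: measurable_funM => //; apply: measurable_funB.
  by apply: measurable_sum => j; apply: measurable_funM => //; exact: measurable_nth.
have := (measurable_EFinP _ _).2 H; congr measurable_fun.
apply/funext => s /=; rewrite in_simplex_forall ?size_tuple//.
by rewrite (sum_seq_ord (size_tuple s)) (dot_seq_mkseq _ (size_tuple s)).
Qed.

End row_sequences.

Section cone_region.
Variables (R : realType) (d : nat) (v : 'I_d.+1 -> 'rV[R]_d).
Variables (c : 'rV[R]_d) (q : nat) (a : 'rV[R]_d) (b : R).
Local Notation mR := (measurableTypeR R).
Local Notation leb := (@lebesgue_measure R).

(* Away from [z = 0] the second condition says [z ^+ e * f (z^-1 *: x) <= y]. *)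
Definition cone_region (e : nat) : set ('rV[R]_d * R * R) :=
  [set p | let: (x, y, z) := p in
     [&& y <= mu_hom a b x z, z ^+ e * dotp c x ^+ q <= z ^+ q * y,
         in_cone v x z, 0 < z & z <= 1]].

Lemma measurable_dotp_row (g : 'rV[R]_d) :
  measurable_fun [set: (mR * d.-tuple mR) * mR]
    (fun p => dotp g (\row_(j < d) nth 0 (tval p.1.2) j) : mR).
Proof.
rewrite /dotp; apply: measurable_sum => j.
under eq_fun do rewrite mxE.
apply: measurable_funM => //.
apply: (@measurableT_comp _ _ _ _ _ _ (fun p : mR * d.-tuple mR => nth 0 (tval p.2) j : mR) _ fst) => //.
exact: measurable_nth_snd.
Qed.

Lemma measurable_region_cone e : measurable_region (cone_region e).
Proof.
rewrite /measurable_region.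
have mz : measurable_fun [set: (mR * d.-tuple mR) * mR] (fun p => p.1.1 : mR).
  by apply: (@measurableT_comp _ _ _ _ _ _ fst _ fst).
have my : measurable_fun [set: (mR * d.-tuple mR) * mR] (fun p => p.2 : mR).
  exact: measurable_snd.
have mcoord j : measurable_fun [set: (mR * d.-tuple mR) * mR]
    (fun p => simplex_coord v (\row_(j < d) nth 0 (tval p.1.2) j) p.1.1 0 j : mR).
  under eq_fun do rewrite mxE.
  apply: measurable_sum => k.
  under eq_fun do rewrite !mxE.
  apply: measurable_funM => //; apply: measurable_funB; last exact: measurable_funM.
  apply: (@measurableT_comp _ _ _ _ _ _ (fun p : mR * d.-tuple mR => nth 0 (tval p.2) k : mR) _ fst) => //.
  exact: measurable_nth_snd.
rewrite (_ : (fun p => _) = fun p : (mR * d.-tuple mR) * mR =>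
  let x := \row_(j < d) nth 0 (tval p.1.2) j in
  if [&& p.2 <= mu_hom a b x p.1.1, p.1.1 ^+ e * dotp c x ^+ q <= p.1.1 ^+ q * p.2,
         in_cone v x p.1.1, 0 < p.1.1 & p.1.1 <= 1] then 1 else 0); last first.
  apply/funext => p; rewrite indicE /=.
  by case: ifPn => h; [rewrite mem_set|rewrite memNset//; exact: (elimN idP h)].
apply: measurable_fun_ifT => //.
do ![apply: measurable_and].
- apply: measurable_fun_ler => //; apply: measurable_funD; first exact: measurable_dotp_row.
  exact: measurable_funM.
- apply: measurable_fun_ler; last by apply: measurable_funM => //; exact: measurable_funX.
  apply: measurable_funM; first exact: measurable_funX.
  by apply: measurable_funX; exact: measurable_dotp_row.
- by apply: measurable_forall => j; apply: measurable_fun_ler => //; exact: mcoord.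
- apply: measurable_fun_ler => //; apply: measurable_sum => j; exact: mcoord.
- exact: measurable_fun_ltr.
- exact: measurable_fun_ler.
Qed.

End cone_region.

(** * Slices of the cone regions at fixed height *)

Section cone_region_volume.
Variables (R : realType) (d : nat) (v : 'I_d.+1 -> 'rV[R]_d).
Variables (c : 'rV[R]_d) (q : nat) (a : 'rV[R]_d) (b : R).
Hypothesis v_free : affinely_independent v.
Hypothesis q_even : ~~ odd q.
Hypothesis mu_vertex : forall i, dotp a (v i) + b = dotp c (v i) ^+ q.
Local Notation mR := (measurableTypeR R).
Local Notation leb := (@lebesgue_measure R).
Local Notation w i := (dotp c (v i)).

Definition vertex_pow (k : nat) : seq R :=
  mkseq (row_entry (\row_j w (lift ord0 j) ^+ k)) d.

(** Barycentric interpolation of the [w_i ^ k]: the pullback of [c.x] for [k = 1], that of [mu] for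
    [k = q]. *)
Definition bary_pow (k : nat) (s : seq R) : R :=
  (1 - \sum_(x <- s) x) * w ord0 ^+ k + dot_seq (vertex_pow k) s.

Lemma bary_powE k s : size s = d -> bary_pow k s =
  (1 - \sum_(j < d) nth 0 s j) * w ord0 ^+ k + \sum_(j < d) nth 0 s j * w (lift ord0 j) ^+ k.
Proof.
move=> sd; rewrite /bary_pow (sum_seq_ord sd) (dot_seq_mkseq _ sd); congr (_ + _).
by apply: eq_bigr => j _; rewrite row_entryE mxE.
Qed.

Lemma bary_pow_jensen s : size s = d -> in_simplex 1 s ->
  bary_pow 1 s ^+ q <= bary_pow q s.
Proof.
move=> sd; rewrite (in_simplex_forall _ sd) => /andP[/forallP s0 s1].
pose lam (i : 'I_d.+1) := if unlift ord0 i is Some j then nth 0 s j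
  else 1 - \sum_(j < d) nth 0 s j.
have lam_lift (j : 'I_d) : lam (lift ord0 j) = nth 0 s j by rewrite /lam liftK.
have lam_0 : lam ord0 = 1 - \sum_(j < d) nth 0 s j by rewrite /lam unlift_none.
have lamE k : bary_pow k s = \sum_i lam i * w i ^+ k.
  rewrite bary_powE// big_ord_recl lam_0; congr (_ + _).
  by apply: eq_bigr => j _; rewrite lam_lift.
rewrite !lamE; under eq_bigr do rewrite expr1.
apply: jensen_even => //.
  move=> i; case: (unliftP ord0 i) => [j ->|->]; first by rewrite lam_lift.
  by rewrite lam_0 subr_ge0.
rewrite big_ord_recl; under eq_bigr do rewrite lam_lift.
by rewrite lam_0 subrK.
Qed.

(** Kept as a homothety, with offset 0, followed by an affine map, so that both change-of-variables
    lemmas match it literally. *)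
Definition cone_seq (z : R) (s : seq R) : seq R :=
  affine_seq d (mx_entry (edge_mx v)) (row_entry (z *: v ord0))
    (mkseq (fun j => z * nth 0 s j + 0) d).

Lemma row_cone_seq z s : \row_(j < d) nth 0 (cone_seq z s) j =
  z *: v ord0 + (z *: \row_(j < d) nth 0 s j) *m edge_mx v.
Proof.
rewrite row_affine_seq; congr (_ + _ *m _).
by apply/rowP => j; rewrite !mxE nth_mkseq// addr0.
Qed.

Lemma cone_region_cone_seq e z s y : 0 < z <= 1 -> size s = d ->
  cone_region v c q a b e (seq_point d (cone_seq z s) y z) <->
  in_simplex 1 s /\ y \in `[z ^+ e * bary_pow 1 s ^+ q, z * bary_pow q s].
Proof.
move=> /andP[z0 z1] sd; rewrite /cone_region /seq_point /= row_cone_seq.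
set u := z *: (\row_(j < d) nth 0 s j); set x := z *: v ord0 + _.
have coneE : in_cone v x z = in_simplex 1 s.
  rewrite /in_cone /x simplex_coordK// (in_simplex_forall _ sd); congr (_ && _).
    by apply: eq_forallb => j; rewrite !mxE pmulr_rge0.
  under eq_bigr do rewrite !mxE.
  by rewrite -mulr_sumr -[X in _ <= X]mulr1 ler_pM2l.
have sumu (F : 'I_d -> R) : \sum_j u 0 j * F j = z * \sum_(j < d) nth 0 s j * F j.
  by rewrite mulr_sumr; apply: eq_bigr => j _; rewrite /u !mxE mulrA.
have sumu1 : \sum_j u 0 j = z * \sum_(j < d) nth 0 s j.
  by rewrite mulr_sumr; apply: eq_bigr => j _; rewrite /u !mxE.
have muE : mu_hom a b x z = z * bary_pow q s.
  rewrite (mu_hom_cone (om := fun i => w i ^+ q))// sumu sumu1 bary_powE//; ring.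
have cE : dotp c x = z * bary_pow 1 s.
  have -> : dotp c x = mu_hom c 0 x z by rewrite /mu_hom mul0r addr0.
  rewrite (mu_hom_cone (om := fun i => w i))//; last by move=> i; rewrite addr0.
  by rewrite sumu sumu1 bary_powE//= !expr1; ring.
rewrite coneE muE cE exprMn mulrCA ler_pM2l ?exprn_gt0// z0 z1 !andbT in_itv /=.
split; first by move=> /and3P[-> -> ->].
by move=> [-> /andP[-> ->]].
Qed.

Lemma integral_cone_region e z s : (0 < e)%N -> 0 < z <= 1 -> size s = d ->
  (\int[leb]_y (\1_(cone_region v c q a b e) (seq_point d (cone_seq z s) y z))%:E =
   (if in_simplex 1 s then z * bary_pow q s - z ^+ e * bary_pow 1 s ^+ q else 0)%:E)%E.
Proof.
move=> e0 z01 sd; have regE := cone_region_cone_seq e _ z01 sd.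
case: ifPn => ss; last first.
  rewrite integral0_eq// => y _; rewrite indicE memNset// => /regE[ss'].
  by rewrite ss' in ss.
transitivity (\int[leb]_y
    (\1_(`[z ^+ e * bary_pow 1 s ^+ q, z * bary_pow q s]%classic : set mR) y)%:E)%E.
  apply: eq_integral => y _; rewrite !indicE; congr (_%:R%:E); congr nat_of_bool.
  apply/idP/idP; rewrite !inE /=; first by move=> /regE[].
  by move=> ?; apply/regE.
have [z0 z1] := andP z01.
(* The slice is never an empty interval: [z ^ e <= z] because [e > 0] and [z <= 1], and Jensen gives
   [f <= mu]. *)
have le_lo : z ^+ e * bary_pow 1 s ^+ q <= z * bary_pow q s.
  apply: ler_pM.
  - by rewrite exprn_ge0 ?(ltW z0).
  - by rewrite exprn_even_ge0.
  - by case: e e0 {regE} => // e _; rewrite exprS ler_piMr ?exprn_ile1 ?(ltW z0).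
  - exact: bary_pow_jensen.
rewrite integral_indic// setIT /= lebesgue_measure_itv /= lte_fin.
by case: ltgtP le_lo => // -> _; rewrite subrr.
Qed.

(** [mean_pow] and [mean_mu] are the [F] and [M] of the overview: integrals over the standard
    simplex, not divided by its volume. *)
Definition mean_pow : R := q`!%:R / (q + d)`!%:R * hsym (rcons (vertex_pow 1) (w ord0)) q.

Definition mean_mu : R := (\sum_i w i ^+ q) / d.+1`!%:R.

Lemma size_vertex_pow k : size (vertex_pow k) = d.
Proof. exact: size_mkseq. Qed.

Lemma sum_vertex_pow (F : R -> R) k :
  \sum_(x <- rcons (vertex_pow k) (w ord0 ^+ k)) F x = \sum_i F (w i ^+ k).
Proof.
rewrite -cats1 big_cat big_seq1 /= big_ord_recl addrC; congr (_ + _).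
rewrite /vertex_pow /mkseq big_map -[X in iota 0 X]subn0 -/(index_iota 0 d) big_mkord.
by apply: eq_bigr => j _; rewrite row_entryE mxE.
Qed.

Lemma integral_bary_pow : iter_integral d (fun s =>
  (if in_simplex 1 s then bary_pow 1 s ^+ q else 0)%:E) = mean_pow%:E.
Proof.
have := simplex_integral_homogeneous q (w ord0) (vertex_pow 1).
by rewrite size_vertex_pow /bary_pow expr1.
Qed.

(** As [mu] is affine, this is the exponent 1 case of the simplex formula, with vertex values
    [w_i ^ q]. *)
Lemma integral_bary_mu : iter_integral d (fun s =>
  (if in_simplex 1 s then bary_pow q s else 0)%:E) = mean_mu%:E.
Proof.
have := simplex_integral_homogeneous 1 (w ord0 ^+ q) (vertex_pow q).
rewrite size_vertex_pow hsym1 (sum_vertex_pow id) add1n (_ : 1`!%:R = 1 :> R)// mul1r mulrC => <-.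
by apply: eq_iter_integral => s _; rewrite expr1.
Qed.

Lemma in_simplex_pow_ge0 k s : size s = d -> ~~ odd k -> in_simplex 1 s -> 0 <= bary_pow k s.
Proof.
move=> sd ke; rewrite (in_simplex_forall _ sd) => /andP[/forallP s0 s1].
rewrite bary_powE// addr_ge0//; first by rewrite mulr_ge0 ?subr_ge0// exprn_even_ge0.
by apply: sumr_ge0 => j _; rewrite mulr_ge0// exprn_even_ge0.
Qed.

(** Additivity of [iter_integral] asks for nonnegativity on all lists, whereas the integrands are
    controlled on lists of size [d] only; they are therefore replaced by 0 on other sizes. The
    difference is obtained from a sum of nonnegative terms by cancelling a finite one. *)
Lemma integral_bary_diff (al be : R) : 0 <= al -> 0 <= be ->
  (forall s, size s = d -> in_simplex 1 s -> be * bary_pow 1 s ^+ q <= al * bary_pow q s) ->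
  iter_integral d (fun s => (if in_simplex 1 s then
    al * bary_pow q s - be * bary_pow 1 s ^+ q else 0)%:E) =
  (al * mean_mu - be * mean_pow)%:E.
Proof.
move=> al0 be0 le_be_al.
pose m s := (if in_simplex 1 s then bary_pow q s else 0)%:E.
pose g s := (if in_simplex 1 s then bary_pow 1 s ^+ q else 0)%:E.
have ext (G : seq R -> \bar R) : (forall s, size s = d -> 0 <= G s)%E ->
    exists2 G', (forall s, 0 <= G' s)%E & forall s, size s = d -> G' s = G s.
  move=> G0; exists (fun s => if size s == d then G s else 0%E).
    by move=> s; case: eqP => // /G0.
  by move=> s ->; rewrite eqxx.
pose h s := (if in_simplex 1 s then al * bary_pow q s - be * bary_pow 1 s ^+ q else 0)%:E.
have mm : measurable_fun [set: d.-tuple mR] (fun s => m (tval s)).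
  have := @measurable_in_simplex_poly R d 1 (w ord0 ^+ q) (row_entry (\row_j w (lift ord0 j) ^+ q)) 1.
  by congr measurable_fun; apply/funext => s; rewrite expr1.
have mg : measurable_fun [set: d.-tuple mR] (fun s => g (tval s)).
  have := @measurable_in_simplex_poly R d q (w ord0) (row_entry (\row_j w (lift ord0 j) ^+ 1)) 1.
  by congr measurable_fun; apply/funext => s; rewrite /g /bary_pow expr1.
have mh : measurable_fun [set: d.-tuple mR] (fun s => h (tval s)).
  have : measurable_fun [set: d.-tuple mR] (fun s => al%:E * m (tval s) - be%:E * g (tval s))%E.
    by apply: emeasurable_funB; exact: emeasurable_funM.
  congr measurable_fun; apply/funext => s; rewrite /h /m /g -!EFinM -EFinB; congr EFin.
  by case: ifP => //; rewrite !mulr0 subrr.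
have [m' m'0 m'E] : exists2 G', (forall s, 0 <= G' s)%E & forall s, size s = d -> G' s = m s.
  apply: ext => s sd; rewrite lee_fin; case: ifP => // ss.
  exact: in_simplex_pow_ge0.
have [g' g'0 g'E] : exists2 G', (forall s, 0 <= G' s)%E & forall s, size s = d -> G' s = g s.
  by apply: ext => s sd; rewrite lee_fin; case: ifP => // ss; rewrite exprn_even_ge0.
have [h' h'0 h'E] : exists2 G', (forall s, 0 <= G' s)%E & forall s, size s = d -> G' s = h s.
  by apply: ext => s sd; rewrite lee_fin; case: ifP => // ss; rewrite subr_ge0 le_be_al.
have transfer G G' : (forall s : seq R, size s = d -> G' s = G s) ->
    measurable_fun [set: d.-tuple mR] (fun s => G (tval s) : \bar R) ->
    measurable_fun [set: d.-tuple mR] (fun s => G' (tval s) : \bar R).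
  by move=> GG; congr measurable_fun; apply/funext => s; rewrite GG// size_tuple.
have mm' := transfer _ _ m'E mm; have mg' := transfer _ _ g'E mg.
have mh' := transfer _ _ h'E mh.
have Im : iter_integral d m' = mean_mu%:E.
  by rewrite -integral_bary_mu; exact: eq_iter_integral.
have Ig : iter_integral d g' = mean_pow%:E.
  by rewrite -integral_bary_pow; exact: eq_iter_integral.
have mbg : measurable_fun [set: d.-tuple mR] (fun s => be%:E * g' (tval s))%E.
  exact: emeasurable_funM.
have : (iter_integral d h' + be%:E * iter_integral d g' = al%:E * iter_integral d m')%E.
  rewrite -!iter_integralZl// -iter_integralD//; last first.
    by move=> s; rewrite mule_ge0.
  apply: eq_iter_integral => s sd; rewrite h'E// g'E// m'E// /h /g /m -!EFinM -EFinD.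
  by congr EFin; case: ifP => _; rewrite ?subrK// !mulr0 addr0.
rewrite Im Ig -!EFinM => /(congr1 (fun x => x - (be * mean_pow)%:E)%E).
rewrite addeK// -EFinB => <-.
by apply: eq_iter_integral => s sd; rewrite h'E.
Qed.

End cone_region_volume.

(** * Volumes of the two relaxations *)

Lemma horner_deriv_monomial_diff (R : realType) (A B : R) m n z :
  ((A / m.+1%:R)%:P * 'X^(m.+1) - (B / n.+1%:R)%:P * 'X^(n.+1))^`().[z] =
  A * z ^+ m - B * z ^+ n.
Proof.
have mono C k : ((C / k.+1%:R)%:P * 'X^(k.+1))^`().[z] = C * z ^+ k.
  rewrite derivM derivC mul0r add0r derivXn hornerM hornerC hornerMn hornerXn /=.
  by rewrite -[z ^+ k *+ _]mulr_natr [z ^+ k * _]mulrC mulrA divfK// pnatr_eq0.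
by rewrite derivB hornerD hornerN !mono.
Qed.

Section relaxation_volumes.
Variables (R : realType) (d : nat) (v : 'I_d.+1 -> 'rV[R]_d).
Variables (c : 'rV[R]_d) (q : nat) (a : 'rV[R]_d) (b : R).
Hypothesis v_free : affinely_independent v.
Hypothesis q_even : ~~ odd q.
Hypothesis mu_vertex : forall i, dotp a (v i) + b = dotp c (v i) ^+ q.
Local Notation mR := (measurableTypeR R).
Local Notation leb := (@lebesgue_measure R).
Local Notation f := (fun x : 'rV[R]_d => dotp c x ^+ q).
Local Notation M := (mean_mu v c q).
Local Notation F := (mean_pow v c q).

Lemma vol_cone_region : exists2 K : R, 0 < K & forall e, (0 < e)%N ->
  vol (cone_region v c q a b e) = (K * (M / (d + 2)%:R - F / (e + d + 1)%:R))%:E.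
Proof.
have [K0 K0_gt0 HK] :=
  iter_integral_affine (row_injective_unitmx (edge_mx_unit v_free)).
exists K0^-1; first by rewrite invr_gt0.
move=> e e0.
have mreg := measurable_region_cone v c q a b e.
rewrite volE_zxy//.
pose G (z : mR) (s : seq R) :=
  (\int[leb]_y (\1_(cone_region v c q a b e) (seq_point d s y z))%:E)%E.
have G0 z s : (0 <= G z s)%E by apply: integral_ge0 => y _; rewrite lee_fin.
have mG : seq_measurable d G.
  apply: (measurable_fun_fubini_tonelli_F (m2 := leb)
    (fun p : (mR * d.-tuple mR) * mR =>
      (\1_(cone_region v c q a b e) (seq_point d (tval p.1.2) p.2 p.1.1))%:E)).
    exact: ((measurable_EFinP _ _).2 mreg).
  by move=> p; rewrite lee_fin.
(* An antiderivative of the slice integral: the Jacobian [z ^ d] of the homothety multiplies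
   [z M - z ^ e F]. *)
pose p : {poly R} := (K0^-1 * M / d.+2%:R)%:P * 'X^(d.+2) -
  (K0^-1 * F / (e + d).+1%:R)%:P * 'X^((e + d).+1).
have p'E z : p^`().[z] = K0^-1 * M * z ^+ d.+1 - K0^-1 * F * z ^+ (e + d).
  exact: horner_deriv_monomial_diff.
have sliceE z : 0 < z <= 1 -> iter_integral d (G z) = (p^`().[z])%:E.
  move=> z01; have /andP[z0 z1] := z01.
  have mGz := seq_measurable_section z mG.
  have h1 := HK (row_entry (z *: v ord0)) _ mGz (G0 z).
  have mGa : measurable_fun [set: d.-tuple mR] (fun s => G z (affine_seq d
      (mx_entry (edge_mx v)) (row_entry (z *: v ord0)) (tval s))).
    apply: (@measurable_mkseq_comp _ _ _ d (G z) (fun j (s : d.-tuple mR) =>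
      row_entry (z *: v ord0) j + \sum_(i < d) nth 0 (tval s) i * mx_entry (edge_mx v) i j)) => //.
    move=> j _; apply: measurable_funD => //; apply: measurable_sum => i.
    by apply: measurable_funM => //; exact: measurable_nth.
  have h2 := @iter_integral_homothety R d (fun s => G z (affine_seq d
      (mx_entry (edge_mx v)) (row_entry (z *: v ord0)) s)) z (fun=> 0) z0 mGa (fun s => G0 z _).
  have h3 : iter_integral d (fun s => G z (cone_seq v z s)) = (z * M - z ^+ e * F)%:E.
    rewrite -(integral_bary_diff (v := v) (c := c) q_even (ltW z0) (exprn_ge0 e (ltW z0))).
      by apply: eq_iter_integral => s sd; exact: integral_cone_region.
    move=> s sd ss; apply: ler_pM.
    - by rewrite exprn_ge0 ?(ltW z0).
    - by rewrite exprn_even_ge0.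
    - by case: e e0 {mreg G G0 mG p p'E mGz h1 mGa h2} => // e _;
        rewrite exprS ler_piMr ?exprn_ile1 ?(ltW z0).
    - exact: bary_pow_jensen.
  move: h2; rewrite -[X in X = _]/(iter_integral d (fun s => G z (cone_seq v z s))) h3 h1.
  move=> /(congr1 (fun x => (K0^-1 * z ^+ d)%:E * x)%E).
  rewrite !muleA -!EFinM p'E.
  have -> : K0^-1 * z ^+ d / z ^+ d * K0 = 1.
    by rewrite mulfK ?expf_neq0 ?gt_eqF// mulVf ?gt_eqF.
  rewrite mul1e => <-; congr EFin; rewrite exprD exprS.
  by ring.
transitivity (\int[leb]_(z in `[0%R, 1%R]) (p^`().[z])%:E)%E.
  rewrite [RHS]integral_mkcond; apply: eq_integral => z _; rewrite patchE.
  have [z01|z01] := boolP (0 < z <= 1).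
    rewrite mem_set /=; last by rewrite in_itv /=; case/andP: z01 => /ltW -> ->.
    exact: sliceE.
  have -> : iter_integral d (G z) = 0%E.
    rewrite -(iter_integral0 R d); apply: eq_iter_integral => s _.
    rewrite /G integral0_eq// => y _; rewrite indicE memNset//=.
    by move=> /and5P[_ _ _ z0 z1]; rewrite z0 z1 in z01.
  case: ifPn => //; rewrite inE /= in_itv /= => /andP[z0 z1].
  have -> : z = 0.
    by apply/eqP; rewrite eq_le z0 andbT leNgt; apply: contra z01 => ->.
  rewrite p'E expr0n -(prednK e0) addSn expr0n /=; congr EFin; ring.
rewrite integral_deriv_poly// /p; congr EFin.
have mono (C t : R) k : (C%:P * 'X^k).[t] = C * t ^+ k.
  by rewrite hornerM hornerC hornerXn.
rewrite !hornerD !hornerN !mono !expr1n !expr0n /= addn2 addn1.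
by rewrite !mulr0 subr0 subr0 !mulr1 mulrBr !mulrA.
Qed.

Lemma naive_relax_region x y z : z != 0 ->
  naive_relax f a b (conv_hull v) (x, y, z) <-> cone_region v c q a b q (x, y, z).
Proof.
move=> z0; rewrite /naive_relax /cone_region /=; split.
  move=> [muy [fy [Jx /andP[z_ge0 z1]]]].
  have z_gt0 : 0 < z by rewrite lt_def z0.
  by rewrite muy ler_pM2l ?exprn_gt0// fy z_gt0 z1 (scale_conv_hullP v_free _ z_ge0).1.
move=> /and5P[muy + Jx z_gt0 z1]; rewrite ler_pM2l ?exprn_gt0// => fy.
rewrite muy fy (ltW z_gt0) z1; do 3 split => //.
exact/(scale_conv_hullP v_free _ (ltW z_gt0)).
Qed.

Lemma closed_le_fun (T : topologicalType) (g h : T -> R) :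
  continuous g -> continuous h -> closed [set p | g p <= h p].
Proof.
move=> cg ch.
rewrite (_ : mkset _ = (fun p => h p - g p) @^-1` [set x | 0 <= x]); last first.
  by apply/seteqP; split => p /=; rewrite subr_ge0.
apply: preimage_closed; last exact: closed_ge.
by move=> p _; apply: cvgB; [exact: ch|exact: cg].
Qed.

Lemma continuous_sumr (T : topologicalType) (I : Type) (r : seq I) (g : I -> T -> R) :
  (forall i, continuous (g i)) -> continuous (fun p => \sum_(i <- r) g i p).
Proof.
move=> cg; elim: r => [|i r IH].
  by under eq_fun do rewrite big_nil; exact: cst_continuous.
under eq_fun do rewrite big_cons.
by move=> p; apply: cvgD; [exact: cg|exact: IH].
Qed.

(* Clearing the denominator of [z * f (z^-1 *: x) <= y] turns the perspective
   relaxation away from [z = 0] into a closed condition. *)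
Lemma persp_relax_region x y z : z != 0 ->
  persp_relax f a b (conv_hull v) (x, y, z) <-> cone_region v c q a b 1 (x, y, z).
Proof.
move=> z_neq0.
have perspE (x' : 'rV[R]_d) y' z' : 0 < z' ->
    (z' * dotp c (z'^-1 *: x') ^+ q <= y') =
    (z' ^+ 1 * dotp c x' ^+ q <= z' ^+ q * y').
  move=> z'0; rewrite linearZ /= exprMn exprVn mulrCA mulrC ler_pdivrMr ?exprn_gt0//.
  by rewrite expr1 [y' * _]mulrC.
split; last first.
  move=> /and5P[muy fy Jx z0 z1]; apply: subset_closure => /=.
  rewrite muy perspE// fy z0 z1; do 3 split => //.
  exact/(scale_conv_hullP v_free _ (ltW z0)).
(* The region with [0 < z] relaxed to [0 <= z]: a closed set containing the points whose closure is
   taken, and equal to the region off [z = 0]. *)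
pose C := [set p : 'rV[R]_d * R * R |
   p.1.2 <= mu_hom a b p.1.1 p.2] `&`
  [set p : 'rV[R]_d * R * R | p.2 ^+ 1 * dotp c p.1.1 ^+ q <= p.2 ^+ q * p.1.2] `&`
  \bigcap_(j in [set: 'I_d]) [set p : 'rV[R]_d * R * R | 0 <= simplex_coord v p.1.1 p.2 0 j] `&`
  [set p : 'rV[R]_d * R * R | \sum_j simplex_coord v p.1.1 p.2 0 j <= p.2] `&`
  [set p : 'rV[R]_d * R * R | 0 <= p.2] `&` [set p : 'rV[R]_d * R * R | p.2 <= 1].
have cz : continuous (fun p : 'rV[R]_d * R * R => p.2) by move=> p; exact: cvg_snd.
have cy : continuous (fun p : 'rV[R]_d * R * R => p.1.2).
  by move=> p; apply: (@continuous_comp _ _ _ fst snd); [exact: cvg_fst|exact: cvg_snd].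
have cx j : continuous (fun p : 'rV[R]_d * R * R => p.1.1 0 j).
  move=> p; apply: (@continuous_comp _ _ _ (fun p : 'rV[R]_d * R * R => p.1.1)
    (fun x : 'rV[R]_d => x 0 j)); last exact: coord_continuous.
  by apply: (@continuous_comp _ _ _ fst fst); exact: cvg_fst.
have cX (g : 'rV[R]_d * R * R -> R) n : continuous g -> continuous (fun p => g p ^+ n).
  move=> cg p; apply: (@continuous_comp _ _ _ g (fun t => t ^+ n)); first exact: cg.
  exact: exprn_continuous.
have cdot (g : 'rV[R]_d) : continuous (fun p : 'rV[R]_d * R * R => dotp g p.1.1).
  rewrite /dotp; apply: continuous_sumr => j p.
  by apply: cvgM; [exact: cvg_cst|exact: cx].
have ccoord j : continuous (fun p : 'rV[R]_d * R * R => simplex_coord v p.1.1 p.2 0 j).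
  under eq_fun do rewrite mxE.
  apply: continuous_sumr => k; under eq_fun do rewrite !mxE.
  move=> p; apply: cvgM; last exact: cvg_cst.
  apply: cvgB; first exact: cx.
  by apply: cvgM; [exact: cz|exact: cvg_cst].
have closedC : closed C.
  do ![apply: closedI].
  - apply: closed_le_fun => //; rewrite /mu_hom => p; apply: cvgD; first exact: cdot.
    by apply: cvgM; [exact: cvg_cst|exact: cz].
  - apply: closed_le_fun => p; apply: cvgM; try exact: cX; exact: cy.
  - apply: closed_bigI => j _; apply: closed_le_fun; last exact: ccoord.
    exact: cst_continuous.
  - by apply: closed_le_fun => //; apply: continuous_sumr.
  - by apply: closed_le_fun => //; exact: cst_continuous.
  - by apply: closed_le_fun => //; exact: cst_continuous.
move=> Pxyz.
have : C (x, y, z).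
  rewrite (closure_id C).1//; move: Pxyz; apply: closureS => -[[x' y'] z'] /=.
  move=> [muy [fy [Jx /andP[z'0 z'1]]]].
  have /andP[/forallP J1 J2] := (scale_conv_hullP v_free _ (ltW z'0)).1 Jx.
  rewrite perspE// in fy.
  exact: (conj (conj (conj (conj (conj muy fy) (fun j _ => J1 j)) J2) (ltW z'0)) z'1).
move=> [[[[[/= muy fy] J1] J2] z0] z1].
rewrite /cone_region /= muy fy z1 lt_def z_neq0 z0 /in_cone J2 !andbT.
by apply/forallP => j; exact: J1.
Qed.

End relaxation_volumes.

(** * The final inequality *)

(** If all [c.v_i] vanished, [c] would be orthogonal to the edges from [v ord0], which form a
    basis. *)
Lemma sum_vertex_pow_gt0 (R : realType) (d : nat) (v : 'I_d.+1 -> 'rV[R]_d)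
    (c : 'rV[R]_d) (q : nat) :
  affinely_independent v -> c != 0 -> ~~ odd q -> 0 < \sum_i dotp c (v i) ^+ q.
Proof.
move=> v_free c0 q_even.
have w0 i : 0 <= dotp c (v i) ^+ q by rewrite exprn_even_ge0.
rewrite lt_def sumr_ge0// andbT; apply: contra c0 => /eqP S0.
have wz i : dotp c (v i) = 0.
  have /(_ i isT)/eqP := psumr_eq0P (fun i _ => w0 i) S0.
  by rewrite expf_eq0 => /andP[_ /eqP].
have : edge_mx v *m c^T = 0.
  apply/colP => i; rewrite !mxE.
  transitivity (dotp c (v (lift ord0 i) - v ord0)); last by rewrite linearB /= !wz subrr.
  by apply: eq_bigr => j _; rewrite !mxE mulrC.
move=> /(congr1 (mulmx (invmx (edge_mx v)))).
rewrite mulKmx ?edge_mx_unit// mulmx0 => /(congr1 trmx).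
by rewrite trmxK trmx0 => /eqP.
Qed.

(* To be used with [x = d + 2] and [y = q + d + 1]. *)
Lemma relaxation_ratio_le (R : realType) (K M F x y D : R) :
  0 < K -> 0 < F -> F <= M -> 0 < x -> x < y -> y * M <= D * F ->
  (y - x) / (D - x) <=
  (K * (M / x - F / y) - K * (M / x - F / x)) / (K * (M / x - F / y)).
Proof.
move=> K0 F0 FM x0 xy DF; have y0 := lt_trans x0 xy.
have yx0 : 0 < y - x by rewrite subr_gt0.
have De0 : 0 < y * M - x * F.
  by rewrite subr_gt0; apply: lt_le_trans (_ : y * F <= _); rewrite ?ltr_pM2r ?ler_pM2l.
have -> : (K * (M / x - F / y) - K * (M / x - F / x)) / (K * (M / x - F / y)) =
    (y - x) * (F / (y * M - x * F)).
  have h : M / x - F / y = (y * M - x * F) / (x * y) by field; rewrite !gt_eqF.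
  rewrite h; field; rewrite !gt_eqF//.
rewrite ler_wpM2l ?(ltW yx0)// -[F / _]invf_div.
have DeF : 0 < (y * M - x * F) / F by rewrite divr_gt0.
have le : (y * M - x * F) / F <= D - x by rewrite ler_pdivrMr// mulrBl lerD2r.
by rewrite lef_pV2 ?posrE// (lt_le_trans DeF).
Qed.

Theorem theorem12 (R : realType) (d : nat) (v : 'I_d.+1 -> 'rV[R]_d)
    (c : 'rV[R]_d) (q : nat) (a : 'rV[R]_d) (b : R) :
  affinely_independent v ->
  (forall x, conv_hull v x -> (forall j, 0 <= x 0 j) /\ x != 0) ->
  c != 0 ->
  (0 < q)%N -> ~~ odd q ->
  (forall i, dotp a (v i) + b = (dotp c (v i)) ^+ q) ->
  let f := fun x : 'rV[R]_d => (dotp c x) ^+ q in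
  let J := conv_hull v in
  let V0 := fine (vol (naive_relax f a b J)) in
  let V := fine (vol (persp_relax f a b J)) in
  (V0 - V) / V0 >=
    (q%:R - 1) /
    ((q + d + 1)`!%:R / (q`! * (d + 1)`!)%:R * 2 ^+ (q./2) * (q./2)`!%:R
      - (d + 2)%:R).
Proof.
move=> v_free _ c0 q0 q_even mu_vertex; cbv zeta.
set V0 := fine (vol (naive_relax _ _ _ _)); set V := fine (vol (persp_relax _ _ _ _)).
have [K K0 volE] := vol_cone_region v_free q_even mu_vertex.
set S := \sum_i dotp c (v i) ^+ q.
pose F := mean_pow v c q; pose M := mean_mu v c q.
have V0E : V0 = K * (M / (d + 2)%:R - F / (q + d + 1)%:R).
  rewrite /V0 (@vol_eq_z0 _ _ _ (cone_region v c q a b q)) ?volE//.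
    exact: measurable_region_cone.
  by move=> x y z z0; exact: naive_relax_region.
have VE : V = K * (M / (d + 2)%:R - F / (1 + d + 1)%:R).
  rewrite /V (@vol_eq_z0 _ _ _ (cone_region v c q a b 1)) ?volE//.
    exact: measurable_region_cone.
  by move=> x y z z0; exact: persp_relax_region.
have S0 : 0 < S by exact: sum_vertex_pow_gt0.
set P := q./2.
have qE : q = P.*2 by rewrite even_halfK.
have q1 : (1 < q)%N by move: q0 q_even; case: (q) => [|[|]].
have P0 : (0 < P)%N by rewrite half_gt0.
pose h := hsym (rcons (vertex_pow v c 1) (dotp c (v ord0))) q.
have DP0 : 0 < 2 ^+ P * P`!%:R :> R.
  by rewrite mulr_gt0 ?exprn_gt0 ?ltr0n ?fact_gt0.
have hS : S <= 2 ^+ P * P`!%:R * h.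
  have := hsym_even_ge_power_sum (rcons (vertex_pow v c 1) (dotp c (v ord0))) P0.
  rewrite -qE (sum_vertex_pow v c (fun x => x ^+ q) 1) ler_pdivrMr//.
  by rewrite mulrC.
have FE : F = q`!%:R / (q + d)`!%:R * h by [].
have h0 : 0 < h.
  by rewrite -(pmulr_rgt0 h DP0); exact: lt_le_trans hS.
have F0 : 0 < F by rewrite FE mulr_gt0// divr_gt0 ?ltr0n ?fact_gt0.
have d2 : 0 < (d + 2)%:R :> R by rewrite ltr0n addn2.
have E1 : (1 + d + 1 = d + 2)%N by rewrite add1n addn1 addn2.
(* For [e = 1] both fractions have denominator [d + 2], so [F <= M] is read off the nonnegativity of
   that volume. *)
have FM : F <= M.
  have : (0 <= vol (cone_region v c q a b 1))%E.
    by apply: iter_integral_ge0 => s; rewrite lee_fin.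
  by rewrite volE// lee_fin E1 -mulrBl pmulr_rge0// pmulr_lge0 ?invr_gt0// subr_ge0.
rewrite V0E VE E1.
have -> : q%:R - 1 = (q + d + 1)%:R - (d + 2)%:R :> R by rewrite !natrD; ring.
apply: relaxation_ratio_le => //.
  by rewrite ltr_nat addn1 addn2 ltnS -[d.+1]add1n ltn_add2r.
rewrite FE /M /mean_mu -/S !addn1 [(q + d).+1`!]factS [((q + d).+1 * _)%:R]natrM [(q`! * _)%:R]natrM.
apply: le_trans (_ : (q + d).+1%:R * ((2 ^+ P * P`!%:R * h) / d.+1`!%:R) <= _).
  by apply: ler_wpM2l => //; apply: ler_wpM2r => //; rewrite invr_ge0.
rewrite le_eqVlt; apply/orP; left; apply/eqP.
move: (fact_neq0 R q) (fact_neq0 R (q + d)) (fact_neq0 R d.+1).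
move: (q`!%:R) ((q + d)`!%:R) (d.+1`!%:R) ((q + d).+1%:R) (2 ^+ P) (P`!%:R) => x1 x2 x3 x4 x5 x6 n1 n2 n3.
by field; rewrite n1 n2 n3.
Qed.
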